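(* Let $n\ge 1$, $J\ge 1$, and $\vec{p}=(p_1,\ldots,p_J)\in[0,1]^J$. For each $j=1,\ldots,J$, let $n_j$ be an integer satisfying $1\le n_j\le n$ and let $\pi_j:\mathbb{R}^n\to\mathbb{R}^{n_j}$ be a surjective linear map; write $\vec{\pi}=(\pi_1,\ldots,\pi_J)$. There exist constants $c,C\in(0,\infty)$, depending on $\vec{\pi}$ and $\vec{p}$, such that \[c\,\sup_{V\le \mathbb{R}^n}R^{\dim V-\sum_{j=1}^Jp_j\dim\pi_j(V)}\;\le\; \underline{\mathrm{BL}}(\vec{\pi},\vec{p},R)\;\le\; C\,\sup_{V\le \mathbb{R}^n}R^{\dim V-\sum_{j=1}^Jp_j\dim\pi_j(V)}\] for all $R\ge 1$, where the suprema are taken over all linear subspaces $V$ of $\mathbb{R}^n$.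
   Context: For $R>0$, $\vec{p}\in[0,1]^J$ and a $J$-tuple $\vec{\pi}=(\pi_j)$ of linear maps $\pi_j:\mathbb{R}^n\to\mathbb{R}^{n_j}$, the regularized Brascamp–Lieb constant is \[\underline{\mathrm{BL}}(\vec{\pi},\vec{p},R):=\sup_{\vec{f}}\frac{\int_{[-R,R]^n}\prod_{j=1}^Jf_j(\pi_j(\mathbf{x}))^{p_j}\,d\mathbf{x}}{\prod_{j=1}^J\left(\int_{\mathbb{R}^{n_j}}f_j(\mathbf{x}_j)\,d\mathbf{x}_j\right)^{p_j}},\] where the supremum is over all $\vec{f}=(f_1,\ldots,f_J)$ with each $f_j\in L^1(\mathbb{R}^{n_j})$ nonzero, nonnegative, and constant on each cube of the unit cube lattice of $\mathbb{R}^{n_j}$, i.e. on each set $\mathbf{v}+[0,1)^{n_j}$ with $\mathbf{v}\in\mathbb{Z}^{n_j}$. *)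

(* Defs.v *)
From HB Require Import structures.
From mathcomp Require Import all_boot all_order all_algebra.
From mathcomp Require Import all_classical all_reals all_analysis.

Set Implicit Arguments.
Unset Strict Implicit.
Unset Printing Implicit Defensive.

Import Order.TTheory GRing.Theory Num.Theory.
Import numFieldNormedType.Exports.

Local Open Scope classical_set_scope.
Local Open Scope ring_scope.

(* 'rV[T]_n carries the product sigma-algebra, generated by the coordinates. *)
Section measurable_rV.
Context {d} {T : measurableType d} {n : nat}.

Let coord_rV (i : 'I_n) (x : 'rV[T]_n) : T := x ord0 i.

Let rV_set0 : g_sigma_preimage coord_rV set0.
Proof. exact: sigma_algebra0. Qed.

Let rV_setC A : g_sigma_preimage coord_rV A -> g_sigma_preimage coord_rV (~` A).
Proof. exact: sigma_algebraC. Qed.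

Let rV_bigcup (F : (set 'rV[T]_n)^nat) :
  (forall i, g_sigma_preimage coord_rV (F i)) ->
  g_sigma_preimage coord_rV (\bigcup_i F i).
Proof. exact: sigma_algebra_bigcup. Qed.

HB.instance Definition _ := @isMeasurable.Build (measure_tuple_display d)
  'rV[T]_n (g_sigma_preimage coord_rV) rV_set0 rV_setC rV_bigcup.

End measurable_rV.

Section measurable_fun_rV.
Context d d' (S : measurableType d') (T : measurableType d) (n : nat).

Lemma measurable_coord_rV (i : 'I_n) :
  measurable_fun [set: 'rV[T]_n] (fun x : 'rV[T]_n => x ord0 i).
Proof.
move=> _ Y mY; rewrite setTI; apply: sub_sigma_algebra => /=.
rewrite -bigcup_seq/=; exists i => /=; first by rewrite mem_index_enum.
by exists Y => //; rewrite setTI.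
Qed.

Lemma measurable_boxrV (A : 'I_n -> set T) : (forall i, measurable (A i)) ->
  measurable [set x : 'rV[T]_n | forall i, A i (x ord0 i)].
Proof.
move=> mA; rewrite (_ : [set x | _] =
    \bigcap_(i in [set: 'I_n]) (fun x : 'rV[T]_n => x ord0 i) @^-1` A i).
  apply: fin_bigcap_measurable => // i _.
  by rewrite -[X in measurable X]setTI; exact: measurable_coord_rV.
by apply/seteqP; split=> x /= Ax i; [move=> _|]; exact: Ax.
Qed.

Lemma measurable_fun_rVP (f : S -> 'rV[T]_n) :
  (forall i, measurable_fun [set: S] (fun s => f s ord0 i)) ->
  measurable_fun [set: S] f.
Proof.
move=> mf _ A mA; move: A mA.
suff: (measurable : set (set 'rV[T]_n)) `<=`
      image_set_system setT f (measurable : set (set S)) by [].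
apply: smallest_sub; first exact/sigma_algebra_image/sigma_algebra_measurable.
move=> A; rewrite -bigcup_seq /= => -[i _ [B mB <-]].
by rewrite /image_set_system /= setTI; exact: mf.
Qed.

End measurable_fun_rV.

Section sigma_finite_measureE.
Context d (T : measurableType d) (R : realType) (m : {measure set T -> \bar R})
  (m_sigma_finite : sigma_finite setT m).

Let m' : set T -> \bar R := m.

HB.instance Definition _ := Measure.on m'.
HB.instance Definition _ := Measure_isSigmaFinite.Build _ _ _ m' m_sigma_finite.

Lemma sigma_finite_measureE :
  exists M : {sigma_finite_measure set T -> \bar R}, m = M :> (set T -> \bar R).
Proof. by exists m'. Qed.

End sigma_finite_measureE.

Section lebesgue_rV.
Context {R : realType}.

Definition cons_rV n (x : R * 'rV[R]_n) : 'rV[R]_n.+1 :=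
  \row_i oapp (x.2 ord0) x.1 (unlift ord0 i).

(* n-dimensional Lebesgue measure, as the iterated product of the
   one-dimensional one; on R^0 it is the unit point mass. *)
Fixpoint leb n : set 'rV[R]_n -> \bar R :=
  if n is m.+1 return set 'rV[R]_n -> \bar R
  then pushforward (lebesgue_measure \x leb (n := m))%E (@cons_rV m)
  else \d_ (0 : 'rV[R]_0).
Arguments leb n _ : clear implicits.

Let cons_rV0 n (x : R * 'rV[R]_n) : cons_rV x ord0 ord0 = x.1.
Proof. by rewrite mxE unlift_none. Qed.

Let cons_rVS n (x : R * 'rV[R]_n) i : cons_rV x ord0 (lift ord0 i) = x.2 ord0 i.
Proof. by rewrite mxE liftK. Qed.

Lemma measurable_cons_rV n : measurable_fun [set: R * 'rV[R]_n] (@cons_rV n).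
Proof.
apply: measurable_fun_rVP => i; have [j ->|->] := unliftP ord0 i.
  rewrite (_ : (fun _ => _) = (fun x : 'rV[R]_n => x ord0 j) \o snd).
    exact: (measurableT_comp (measurable_coord_rV j) measurable_snd).
  by apply/funext => x; rewrite cons_rVS.
rewrite (_ : (fun _ => _) = fst) //.
by apply/funext => x; rewrite cons_rV0.
Qed.

Let uncons_rV n (x : 'rV[R]_n.+1) : R * 'rV[R]_n :=
  (x ord0 ord0, \row_i x ord0 (lift ord0 i)).

Let cons_rVK n : cancel (@cons_rV n) (@uncons_rV n).
Proof.
move=> [a x]; rewrite /uncons_rV cons_rV0; congr pair.
by apply/rowP => i; rewrite mxE cons_rVS.
Qed.

Let measurable_uncons_rV n : measurable_fun setT (@uncons_rV n).
Proof.
apply: measurable_fun_pair; first exact: measurable_coord_rV.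
apply: measurable_fun_rVP => i.
rewrite (_ : (fun _ => _) = fun x : 'rV[R]_n.+1 => x ord0 (lift ord0 i)).
  exact: measurable_coord_rV.
by apply/funext => x; rewrite mxE.
Qed.

Let leb_sigma_finite_measure n :
  exists m : {sigma_finite_measure set 'rV[R]_n -> \bar R}, leb n = m.
Proof.
elim: n => [|n [m IHn]] /=; first by exists \d_ (0 : 'rV[R]_0).
rewrite IHn; set mu := pushforward _ _.
have [M muM] : exists M : {measure set 'rV[R]_n.+1 -> \bar R}, mu = M.
  unshelve eexists (pushforward (lebesgue_measure \x m)%E (@cons_rV n)) => //.
  exact: measurable_cons_rV.
have Mfin : sigma_finite setT M.
  have /sigma_finiteP[F [TF ndF Foo]] :=
    sigma_finiteT (@lebesgue_measure R : {sigma_finite_measure set _ -> \bar R}).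
  have /sigma_finiteP[G [TG ndG Goo]] := sigma_finiteT m.
  exists (fun k => @uncons_rV n @^-1` (F k `*` G k)).
    apply/esym; rewrite -subTset => x _.
    have [i _ Fi] : (\bigcup_i F i) (x ord0 ord0) by rewrite -TF.
    have [j _ Gj] : (\bigcup_i G i) (uncons_rV x).2 by rewrite -TG.
    exists (maxn i j) => //; split.
      by have /subsetPset := ndF _ _ (leq_maxl i j); exact.
    by have /subsetPset := ndG _ _ (leq_maxr i j); exact.
  move=> k; have [mF Fk] := Foo k; have [mG Gk] := Goo k; split.
    rewrite -[X in measurable X]setTI; apply: measurable_uncons_rV => //.
    exact: measurableX.
  rewrite -muM /mu /pushforward -comp_preimage.
  rewrite (_ : _ \o _ = id); last by apply/funext => x; exact: cons_rVK.
  by rewrite preimage_id product_measure1E// lte_mul_pinfty// ge0_fin_numE.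
have [m' Mm'] := sigma_finite_measureE Mfin.
by exists m'; rewrite -Mm'.
Qed.

Let leb0 n : leb n set0 = 0%E.
Proof. by have [m ->] := leb_sigma_finite_measure n. Qed.

Let leb_ge0 n A : (0 <= leb n A)%E.
Proof. by have [m ->] := leb_sigma_finite_measure n. Qed.

Let leb_semi_sigma_additive n : semi_sigma_additive (leb n).
Proof.
have [m ->] := leb_sigma_finite_measure n.
exact: measure_semi_sigma_additive.
Qed.

HB.instance Definition _ n := isMeasure.Build _ _ _ (leb n)
  (leb0 n) (@leb_ge0 n) (@leb_semi_sigma_additive n).

Let leb_sigma_finite n : sigma_finite setT (leb n).
Proof.
by have [m ->] := leb_sigma_finite_measure n; exact: sigma_finiteT.
Qed.

HB.instance Definition _ n := Measure_isSigmaFinite.Build _ _ _ (leb n)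
  (leb_sigma_finite n).

(* On boxes leb is the product of the side lengths. *)
Lemma lebX n (A : 'I_n -> set (measurableTypeR R)) : (forall i, measurable (A i)) ->
  leb n [set x | forall i, A i (x ord0 i)] = (\prod_i lebesgue_measure (A i))%E.
Proof.
elim: n A => [|n IHn] A mA.
  by rewrite big_ord0 /= /dirac indicE mem_set // => -[].
rewrite big_ord_recl /= -IHn // -product_measure1E; [|exact: mA|]; last first.
  apply: (@measurable_boxrV _ _ n (fun i => A (lift ord0 i))) => i; exact: mA.
congr ((_ \x _)%E _); apply/seteqP; split=> -[a x] /=.
  move=> Aax; split=> [|i].
    by have := Aax ord0; rewrite cons_rV0.
  by have := Aax (lift ord0 i); rewrite cons_rVS.
by move=> [Aa Ax] i; have [j ->|->] := unliftP ord0 i; rewrite ?cons_rVS ?cons_rV0.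
Qed.

End lebesgue_rV.
Arguments leb {R} n _.

Section regularized_Brascamp_Lieb.
Local Open Scope ereal_scope.
Context {R : realType}.

Definition unit_cube m (v : 'rV[int]_m) : set 'rV[R]_m :=
  [set x | forall i, ((v ord0 i)%:~R <= x ord0 i < (v ord0 i)%:~R + 1)%R].

Definition centered_box n (r : R) : set 'rV[R]_n :=
  [set x | forall i, (- r <= x ord0 i <= r)%R].

Definition BL_admissible m (f : 'rV[R]_m -> R) :=
  [/\ (leb m).-integrable setT (EFin \o f),
      exists x, (f x != 0)%R,
      forall x, (0 <= f x)%R &
      forall (v : 'rV[int]_m) x y, unit_cube v x -> unit_cube v y -> f x = f y].

(* For admissible f every integral in the denominator is positive and finite.
   When p j = 0 and f j vanishes the factor is 0 `^ 0 = 1; this convention does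
   not affect the supremum, as f j may then be replaced by a positive function
   without changing the other factors. *)
Definition BL_ratio n J (d : 'I_J -> nat)
    (pi : forall j, 'Hom('rV[R]_n, 'rV[R]_(d j))) (p : 'I_J -> R) (r : R)
    (f : forall j, 'rV[R]_(d j) -> R) : \bar R :=
  (\int[leb n]_(x in centered_box r) (\prod_j f j (pi j x) `^ p j)%R%:E) /
  (\prod_j (\int[leb (d j)]_y (f j y)%:E) `^ p j).

Definition BL n J (d : 'I_J -> nat)
    (pi : forall j, 'Hom('rV[R]_n, 'rV[R]_(d j))) (p : 'I_J -> R) (r : R) :=
  ereal_sup [set BL_ratio pi p r f | f in
    [set f : forall j, 'rV[R]_(d j) -> R | forall j, BL_admissible (f j)]].

Definition BL_exponent n J (d : 'I_J -> nat)
    (pi : forall j, 'Hom('rV[R]_n, 'rV[R]_(d j))) (p : 'I_J -> R)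
    (V : {vspace 'rV[R]_n}) : R :=
  ((\dim V)%:R - \sum_j p j * (\dim (pi j @: V))%:R)%R.

End regularized_Brascamp_Lieb.

(* Main.v *)
Require Import Defs.
From mathcomp Require Import all_boot all_order all_algebra.
From mathcomp Require Import all_classical all_reals all_analysis.
From mathcomp Require Import measurable_realfun.
From mathcomp Require Import zify ring lra.

(** Write [h V = dim V - \sum_j p_j * dim (pi_j V)].  Only finitely many tuples
of dimensions occur, so [h] has a maximum [g], attained at some [V0], and for
[r >= 1] the supremum in the theorem is [r `^ g].  It remains to compare the
Brascamp-Lieb constant with [r `^ g].

Lower bound.  Test with [f_j] at least one on a bounded neighbourhood of the
image under [pi_j] of the ball of radius [r] in [V0] ([thickened_image]).  A
bounded neighbourhood of that ball has volume at least of order [r ^ dim V0]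
([tube_volume]), while the integral of [f_j] is at most of order
[r ^ dim (pi_j V0)].

Upper bound.  A function constant on unit cubes is controlled by its values at
scattered points: in each unit cube of the box choose one point where the
integrand is at least half its average ([exists_half_average]).  This leaves a
finite sum over points [x_s], and the only property of [f_j] that is retained is
that [\sum_s f_j (pi_j x_s)] is at most the integral of [f_j] whenever the
points [pi_j x_s] are pairwise at distance more than one.  The statement
[discrete_BL] is the resulting inequality, with points of bounded local
multiplicity and arbitrary nonnegative weights.  It does not refer to lattices,
so it survives projections along irrational subspaces.

The discrete inequality with exponent [g] follows from [h <= g] on all subspaces
([discrete_BL_of_rank_condition]) by induction on the dimension [n].
For fixed maps, the pairs [(p, g)] with [0 <= p_j <= 1], [h <= g] and [g <= n]
form a polytope; by Hoelder's inequality ([discrete_BL_convex]) the pairs for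
which the inequality holds form a convex set.  Hence it is enough to treat a
vertex ([polytope_ind], [discrete_BL_vertex]), where one of the following occurs.
- [g = n]: count the points.
- Some [V] with [0 < dim V < n] has [h V = g].  Sum first over the points near
  each translate of [V], then over the translates ([discrete_BL_split]).  The
  subspaces of [V] satisfy the condition with [g], those of the quotient with
  [0] because [h] is maximal at [V], so both sums are given by the induction.
- Some [p_i = 1] with [pi_i] nonzero: split along the kernel of [pi_i] in the same
  way, or sum the [i]-th weight alone if [pi_i] is injective.
- Otherwise the only tight constraints besides those [p_j = 0] and [p_j = 1] come
  from [V = 0] and [V] the whole space, and they leave a direction in
  which [(p, g)] can move, so the point was not a vertex. *)

Set Implicit Arguments.
Unset Strict Implicit.
Unset Printing Implicit Defensive.

Import Order.TTheory GRing.Theory Num.Theory.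
Import numFieldNormedType.Exports.

Local Open Scope ring_scope.

(** * Sup-norm boxes and the integer lattice *)

Section boxes.
Context {R : realType}.

Definition inbox n (r : R) (x : 'rV[R]_n) := [forall i, `|x ord0 i| <= r].

Lemma inboxP n (r : R) (x : 'rV[R]_n) :
  reflect (forall i, `|x ord0 i| <= r) (inbox r x).
Proof. exact: forallP. Qed.

Lemma inbox_le n (r s : R) (x : 'rV[R]_n) : r <= s -> inbox r x -> inbox s x.
Proof. by move=> rs /inboxP xr; apply/inboxP => i; exact: le_trans (xr i) rs. Qed.

Lemma inboxD n (r s : R) (x y : 'rV[R]_n) :
  inbox r x -> inbox s y -> inbox (r + s) (x + y).
Proof.
move=> /inboxP xr /inboxP ys; apply/inboxP => i; rewrite mxE.
exact: le_trans (ler_normD _ _) (lerD _ _).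
Qed.

Lemma inboxN n (r : R) (x : 'rV[R]_n) : inbox r (- x) = inbox r x.
Proof. by apply: eq_forallb => i; rewrite mxE normrN. Qed.

Lemma inboxB n (r s : R) (x y : 'rV[R]_n) :
  inbox r x -> inbox s y -> inbox (r + s) (x - y).
Proof. by move=> xr ys; apply: inboxD => //; rewrite inboxN. Qed.

Lemma inbox0 n (r : R) : 0 <= r -> inbox r (0 : 'rV[R]_n).
Proof. by move=> r0; apply/inboxP => i; rewrite mxE normr0. Qed.

(** The entrywise l1 norm: a convenient bound for the norm of [x |-> x *m A] from
sup norm to sup norm, available in all dimensions including zero. *)
Definition mxl1 m n (A : 'M[R]_(m, n)) : R := \sum_i \sum_j `|A i j|.

Lemma mxl1_ge0 m n (A : 'M[R]_(m, n)) : 0 <= mxl1 A.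
Proof. by apply: sumr_ge0 => i _; apply: sumr_ge0 => j _. Qed.

Lemma inboxM m n (A : 'M[R]_(m, n)) (r : R) (x : 'rV[R]_m) :
  0 <= r -> inbox r x -> inbox (mxl1 A * r) (x *m A).
Proof.
move=> r0 /inboxP xr; apply/inboxP => j; rewrite mxE.
apply: le_trans (ler_norm_sum _ _ _) _; rewrite /mxl1 mulr_suml.
apply: ler_sum => i _; rewrite normrM mulrC ler_pM //.
by rewrite (bigD1 j) //= lerDl sumr_ge0.
Qed.

Definition mxfloor n (x : 'rV[R]_n) : 'rV[int]_n := map_mx Num.floor x.

Definition mxz n (v : 'rV[int]_n) : 'rV[R]_n := map_mx intr v.

Lemma inbox_floor n (x : 'rV[R]_n) : inbox 1 (x - mxz (mxfloor x)).
Proof.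
apply/inboxP => i; rewrite !mxE.
have /andP[lo hi] := floor_itv (x ord0 i).
rewrite ger0_norm ?subr_ge0 //; move: hi; rewrite intrD => hi; lra.
Qed.

Lemma inbox_same_floor n (x y : 'rV[R]_n) :
  mxfloor x = mxfloor y -> inbox 1 (x - y).
Proof.
move=> /rowP xy; apply/inboxP => i; rewrite !mxE.
have /andP[] := floor_itv (x ord0 i); have /andP[] := floor_itv (y ord0 i).
have := xy i; rewrite !mxE => ->; rewrite intrD => a b c e.
by rewrite ler_norml; apply/andP; split; lra.
Qed.

(** Subtracting the lower corner of the box turns the values of [a] into functions
from ['I_n] to a fixed ordinal, and these are counted. *)
Lemma card_box (X : finType) (S : {set X}) n (a : X -> 'rV[int]_n)
    (b : 'rV[R]_n) (K : R) (M : nat) : 0 <= K ->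
  (forall s, s \in S -> inbox K (mxz (a s) - b)) ->
  (forall v, #|[set s in S | a s == v]%SET| <= M)%N ->
  (#|S| <= (Num.truncn (2 * K + 1)).+1 ^ n * M)%N.
Proof.
move=> K0 Sb SM; set m := Num.truncn _.
pose o i := Num.floor (b ord0 i - K).
pose h s : {ffun 'I_n -> 'I_m.+1} := [ffun i => inord `|a s ord0 i - o i|%N].
have hE s i : s \in S -> a s ord0 i = o i + (h s i : nat)%:Z.
  move=> sS; have /inboxP/(_ i) := Sb _ sS; rewrite !mxE ler_norml => /andP[l u].
  have /andP[ol ou] := floor_itv (b ord0 i - K); rewrite intrD in ou.
  have oa : o i <= a s ord0 i.
    by rewrite -(ler_int R); apply: le_trans ol _; lra.
  rewrite ffunE inordK; first by rewrite gez0_abs ?subr_ge0 //; ring.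
  rewrite ltnS -(ler_nat int) !natz gez0_abs ?subr_ge0 //.
  have tr : Num.floor (2 * K + 1) = m%:Z.
    by rewrite /m truncn_floor ifT; last lra; rewrite gez0_abs // floor_ge_int; lra.
  rewrite -tr floor_ge_int intrB; rewrite -/(o i) in ou; lra.
rewrite -sum1_card (partition_big h xpredT) //=.
apply: (@leq_trans (\sum_(j : {ffun 'I_n -> 'I_m.+1}) M)%N).
  apply: leq_sum => y _; rewrite sum1_card.
  have [s0 /andP[s0S /eqP hs0]|no] := pickP (fun s => (s \in S) && (h s == y)).
    apply: leq_trans (SM (a s0)); apply: subset_leq_card; apply/fintype.subsetP => s.
    rewrite unfold_in /= inE => /andP[sS /eqP hs]; rewrite sS /=; apply/eqP/rowP => i.
    by rewrite !hE // hs hs0.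
  by rewrite eq_card0 // => s; rewrite unfold_in /=; exact: no.
by rewrite sum_nat_const card_ffun !card_ord.
Qed.

End boxes.

(** * The discrete inequality for separated sets *)

Section discrete.
Context {R : realType}.

(** Bounded local multiplicity at every scale.  Quantifying over all [K] at once,
with an arbitrary profile [phi], makes the notion stable under affine maps with
no covering argument. *)
Definition spread (X : finType) n (phi : R -> nat) (S : {set X})
    (x : X -> 'rV[R]_n) :=
  forall a K, 0 <= K -> (#|[set s in S | inbox K (x s - a)]%SET| <= phi K)%N.

Definition mx_separated (X : finType) n m (A : 'M[R]_(n, m)) (K : R)
    (x : X -> 'rV[R]_n) (S : {set X}) :=
  forall s t, s \in S -> t \in S -> s != t -> ~~ inbox K ((x s - x t) *m A).

(** The constant depends on the separation scale [K] and the multiplicity profile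
[phi], but not on the configuration [x], the radius [r] or the weights.  The
number [N j] replaces the integral of the [j]-th function: all that is known of
the weights is their sum over sets separated by the [j]-th map. *)
Definition discrete_BL (J : finType) n (d : J -> nat)
    (A : forall j, 'M[R]_(n, d j)) (p : J -> R) (g : R) :=
  forall (K : R) (phi : R -> nat), 0 <= K -> exists2 C : R, 0 <= C &
  forall (X : finType) (S : {set X}) (x : X -> 'rV[R]_n) (r : R)
      (F : J -> X -> R) (N : J -> R),
    1 <= r -> spread phi S x -> (forall s, s \in S -> inbox r (x s)) ->
    (forall j s, 0 <= F j s) -> (forall j, 0 <= N j) ->
    (forall j (S' : {set X}), S' \subset S -> mx_separated (A j) K x S' ->
       \sum_(s in S') F j s <= N j) ->
  \sum_(s in S) \prod_j F j s `^ p j <= C * r `^ g * \prod_j N j `^ p j.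

Lemma separated_weight_le (X : finType) n m (A : 'M[R]_(n, m)) (K N : R)
    (x : X -> 'rV[R]_n) (S : {set X}) (f : X -> R) :
  (forall S' : {set X}, S' \subset S -> mx_separated A K x S' ->
     \sum_(s in S') f s <= N) ->
  forall s, s \in S -> f s <= N.
Proof.
move=> fN s sS; have := fN [set s]%SET; rewrite finset.sub1set sS finset.big_set1; apply=> //.
by move=> t u /finset.set1P-> /finset.set1P->; rewrite eqxx.
Qed.

Lemma discrete_BL_full (J : finType) n (d : J -> nat)
    (A : forall j, 'M[R]_(n, d j)) (p : J -> R) (g : R) :
  (forall j, 0 <= p j) -> n%:R <= g -> discrete_BL A p g.
Proof.
move=> p0 ng K phi K0; exists (6 ^+ n * (phi 1)%:R).
  by rewrite mulr_ge0 // exprn_ge0.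
move=> X S x r F N r1 spS xr F0 N0 FN.
have cS : (#|S|%:R : R) <= 6 ^+ n * (phi 1)%:R * r `^ g.
  have /(_ (r + 1) (phi 1)) := @card_box R X S n (fun s => mxfloor (x s)) 0.
  move=> /(_ ltac:(lra)) cb.
  have {cb}cb : (#|S| <= (Num.truncn (2 * (r + 1) + 1)).+1 ^ n * phi 1%R)%N.
    apply: cb => [s sS|v].
      rewrite subr0 -[mxz _](subKr (x s)); apply: inboxB; first exact: xr.
      exact: inbox_floor.
    apply: leq_trans (spS (mxz v) 1 ler01); apply: subset_leq_card.
    apply/fintype.subsetP => s; rewrite !inE => /andP[-> /eqP <-] /=.
    exact: inbox_floor.
  move: cb; rewrite -(ler_nat R) natrM natrX => /le_trans; apply.
  rewrite mulrAC ler_wpM2r //.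
  have tr : ((Num.truncn (2 * (r + 1) + 1)).+1%:R : R) <= 6 * r.
    have /andP[] := @truncn_itv R (2 * (r + 1) + 1) ltac:(lra).
    rewrite -[(Num.truncn _).+1%:R]natr1; lra.
  apply: (@le_trans _ _ ((6 * r) ^+ n)).
    by apply: lerXn2r; rewrite ?nnegrE ?ler0n //; lra.
  rewrite exprMn ler_wpM2l ?exprn_ge0 // -powR_mulrn; last lra.
  exact: ler_powR.
have FNs s : s \in S -> \prod_j F j s `^ p j <= \prod_j N j `^ p j.
  move=> sS; apply: ler_prod => j _; rewrite powR_ge0 /=.
  apply: ge0_ler_powR; rewrite ?nnegrE //.
  exact: separated_weight_le (FN j) s sS.
apply: le_trans (ler_sum _ FNs) _; rewrite sumr_const -[leLHS]mulr_natl.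
by rewrite ler_wpM2r // prodr_ge0 // => j _; exact: powR_ge0.
Qed.

(** Repeatedly pick a vertex of largest weight and discard its neighbours: each
discarded batch has at most [M] members, none heavier than the vertex picked. *)
Lemma greedy_independent (X : finType) (e : rel X) (M : nat) (f : X -> R)
    (S : {set X}) : symmetric e -> reflexive e -> (forall s, 0 <= f s) ->
  (forall s, s \in S -> #|[set t in S | e s t]%SET| <= M)%N ->
  exists2 S' : {set X}, S' \subset S &
    (forall s t, s \in S' -> t \in S' -> s != t -> ~~ e s t) /\
    \sum_(s in S) f s <= M%:R * \sum_(s in S') f s.
Proof.
move=> esym erefl f0; have [k] := ubnP #|S|; elim: k S => // k IHk S Sk SM.
have [->|[s0 s0S]] := finset.set_0Vmem S.
  exists finset.set0; rewrite ?finset.sub0set //; split; first by move=> s t; rewrite inE.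
  by rewrite !finset.big_set0 mulr0.
case: (@Order.TotalTheory.arg_maxP _ _ _ s0 (fun s => s \in S) f s0S) => s sS smax.
pose B := [set t in S | e s t]%SET; pose T := (S :\: B)%SET.
have BS : B \subset S by apply/fintype.subsetP => t; rewrite inE => /andP[].
have TS : T \subset S by exact: finset.subsetDl.
have sB : s \in B by rewrite inE sS erefl.
have Tk : (#|T| < k)%N.
  rewrite (leq_trans _ (Sk : #|S| <= k)%N) // proper_card // properE TS /=.
  by apply/fintype.subsetPn; exists s => //; rewrite inE sB.
have [|S' S'T [S'e S'M]] := IHk T Tk.
  move=> t tT; apply: leq_trans (SM t (fintype.subsetP TS _ tT)).
  apply: subset_leq_card; apply/fintype.subsetP => u; rewrite !inE.
  by move=> /andP[/andP[_ ->] ->].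
have sS' : s \notin S'.
  by apply/negP => /(fintype.subsetP S'T); rewrite inE sB.
have es t : t \in S' -> ~~ e s t.
  by move=> /(fintype.subsetP S'T); rewrite !inE; case: (t \in S);
    rewrite ?andbF //= andbT.
exists (s |: S')%SET.
  by rewrite finset.subUset finset.sub1set sS (fintype.subset_trans S'T TS).
split=> [t u|].
  rewrite !inE => /orP[/eqP->|tS'] /orP[/eqP->|uS']; first by rewrite eqxx.
  - by move=> _; exact: es.
  - by move=> _; rewrite esym; exact: es.
  - exact: S'e.
rewrite finset.big_setU1 //= mulrDr (finset.big_setID B) /=; apply: lerD => //.
rewrite (finset.setIidPr BS); apply: (@le_trans _ _ (\sum_(t in B) f s)).
  by apply: ler_sum => t /(fintype.subsetP BS); exact: smax.
by rewrite sumr_const -[leLHS]mulr_natl ler_wpM2r // ler_nat; exact: SM.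
Qed.

(** An injective map does not bring distant points together, so up to a bounded factor
the whole sum of the [i]-th weight is one over a separated set; the other factors
are at most [N j `^ p j]. *)
Lemma discrete_BL_injective (J : finType) n (d : J -> nat)
    (A : forall j, 'M[R]_(n, d j)) (p : J -> R) (g : R) (i : J) :
  (forall j, 0 <= p j) -> 0 <= g -> p i = 1 -> row_free (A i) ->
  discrete_BL A p g.
Proof.
move=> p0 g0 pi1 /row_freeP[B AB] K phi K0; pose M := phi (mxl1 B * K).
exists M%:R => // X S x r F N r1 spS xr F0 N0 FN.
pose e s t := inbox K ((x s - x t) *m A i).
have esym : symmetric e by move=> s t; rewrite /e -inboxN -mulNmx opprB.
have erefl : reflexive e by move=> s; rewrite /e subrr mul0mx inbox0.
have [s sS|S' S'S [S'e S'M]] := @greedy_independent X e M (F i) S esym erefl (F0 i).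
  apply: leq_trans (spS (x s) (mxl1 B * K) _); last by rewrite mulr_ge0 // mxl1_ge0.
  apply: subset_leq_card; apply/fintype.subsetP => t; rewrite !inE => /andP[-> /=].
  rewrite esym => /(inboxM B K0); by rewrite -mulmxA AB mulmx1.
have {S'e} S'N : \sum_(s in S') F i s <= N i by exact: FN.
have FNs s : s \in S ->
    \prod_j F j s `^ p j <= F i s * \prod_(j | j != i) N j `^ p j.
  move=> sS; rewrite (bigD1 i) //= pi1 powRr1 // ler_wpM2l //.
  apply: ler_prod => j _; rewrite powR_ge0 /=.
  apply: ge0_ler_powR; rewrite ?nnegrE //.
  exact: separated_weight_le (FN j) s sS.
apply: le_trans (ler_sum _ FNs) _; rewrite -mulr_suml [in leRHS](bigD1 i) //= pi1 powRr1 //.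
rewrite mulrA ler_wpM2r ?prodr_ge0 // => [j _|]; first exact: powR_ge0.
apply: le_trans S'M _; rewrite -mulrA ler_wpM2l // -[leLHS]mul1r ler_pM // ?sumr_ge0 //.
by rewrite -(powRr0 r) ler_powR.
Qed.

Lemma weighted_AM_GM (a b t : R) : 0 <= a -> 0 <= b -> 0 < t < 1 ->
  a `^ t * b `^ (1 - t) <= t * a + (1 - t) * b.
Proof.
move=> a0 b0 /andP[t0 t1].
have := @conjugate_powR R (a `^ t) (b `^ (1 - t)) t^-1 (1 - t)^-1.
rewrite !invrK -!powRrM !mulfV ?powRr1 //; try by apply/lt0r_neq0; lra.
rewrite (mulrC a) (mulrC b); apply; rewrite ?powR_ge0 ?invr_gt0 //; lra.
Qed.

Lemma Hoelder_sum (X : finType) (S : {set X}) (u v : X -> R) (t : R) :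
  (forall s, 0 <= u s) -> (forall s, 0 <= v s) -> 0 < t < 1 ->
  \sum_(s in S) u s `^ t * v s `^ (1 - t) <=
    (\sum_(s in S) u s) `^ t * (\sum_(s in S) v s) `^ (1 - t).
Proof.
move=> u0 v0 t01; have /andP[t0 t1] := t01.
set U := \sum_(s in S) u s; set V := \sum_(s in S) v s.
have U0 : 0 <= U by exact: sumr_ge0.
have V0 : 0 <= V by exact: sumr_ge0.
have [UV0|UV] := eqVneq (U * V) 0.
  rewrite big1 ?mulr_ge0 ?powR_ge0 // => s sS.
  move: UV0 => /eqP; rewrite mulf_eq0 => /orP[] /eqP z.
  - rewrite (psumr_eq0P _ z) // powR0 ?mul0r //; lra.
  - rewrite (psumr_eq0P _ z) // [0 `^ _]powR0 ?mulr0 //; lra.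
move: UV; rewrite mulf_eq0 negb_or => /andP[Un Vn].
have Up : 0 < U by rewrite lt_neqAle eq_sym Un.
have Vp : 0 < V by rewrite lt_neqAle eq_sym Vn.
have Wp : 0 < U `^ t * V `^ (1 - t) by rewrite mulr_gt0 // powR_gt0.
rewrite -[leRHS]mul1r -ler_pdivrMr // mulr_suml.
apply: (@le_trans _ _ (\sum_(s in S) (t * (u s / U) + (1 - t) * (v s / V)))).
  apply: ler_sum => s _; apply: le_trans (weighted_AM_GM _ _ t01); last first.
  - by rewrite divr_ge0.
  - by rewrite divr_ge0.
  have powV (w e : R) : 0 <= w -> w^-1 `^ e = (w `^ e)^-1.
    by move=> w0; rewrite -powR_inv1 // -powRrM mulN1r powRN.
  by rewrite !powRM ?invr_ge0 // !powV // invfM mulrACA.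
rewrite big_split /= -!mulr_sumr -!mulr_suml !mulfV //; lra.
Qed.

Lemma prod_powR_convex (J : finType) (f p q : J -> R) (t : R) : 0 < t < 1 ->
  (forall j, 0 <= f j) -> (forall j, 0 <= p j) -> (forall j, 0 <= q j) ->
  \prod_j f j `^ (t * p j + (1 - t) * q j) =
  (\prod_j f j `^ p j) `^ t * (\prod_j f j `^ q j) `^ (1 - t).
Proof.
move=> /andP[t0 t1] f0 p0 q0.
have prodM (h : J -> R) (e : R) : (forall j, 0 <= h j) ->
    (\prod_j h j) `^ e = \prod_j h j `^ e.
  move=> h0.
  suff [] : 0 <= \prod_j h j /\ (\prod_j h j) `^ e = \prod_j h j `^ e by [].
  elim/big_ind2: _ => [|a b c f1 [a0 ab] [c0 cf]|j _]; first by rewrite powR1.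
    by rewrite mulr_ge0 // powRM // ab cf.
  by rewrite h0.
rewrite !prodM => [|j|j]; try exact: powR_ge0.
rewrite -big_split /=; apply: eq_bigr => j _.
rewrite -!powRrM (mulrC t) (mulrC (1 - t)).
have [pq0|pq] := eqVneq (p j * t + q j * (1 - t)) 0; last first.
  by rewrite powRD // (negPf pq).
have p1 : p j = 0 by have := p0 j; have := q0 j; nra.
have q1 : q j = 0 by have := q0 j; nra.
by rewrite p1 q1 !mul0r addr0 powRr0 mulr1.
Qed.

(** Hoelder's inequality with exponents [t^-1] and [(1 - t)^-1]. *)
Lemma discrete_BL_convex (J : finType) n (d : J -> nat)
    (A : forall j, 'M[R]_(n, d j)) (p q : J -> R) (g h t : R) : 0 < t < 1 ->
  (forall j, 0 <= p j) -> (forall j, 0 <= q j) ->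
  discrete_BL A p g -> discrete_BL A q h ->
  discrete_BL A (fun j => t * p j + (1 - t) * q j) (t * g + (1 - t) * h).
Proof.
move=> t01 p0 q0 Ap Aq K phi K0.
have [C C0 AC] := Ap K phi K0; have [D D0 AD] := Aq K phi K0.
exists (C `^ t * D `^ (1 - t)); first by rewrite mulr_ge0 ?powR_ge0.
move=> X S x r F N r1 spS xr F0 N0 FN.
have {}AC := AC X S x r F N r1 spS xr F0 N0 FN.
have {}AD := AD X S x r F N r1 spS xr F0 N0 FN.
have /andP[t0 t1] := t01.
rewrite (eq_bigr _ (fun s _ => prod_powR_convex t01 (F0^~ s) p0 q0)).
rewrite (prod_powR_convex t01 N0 p0 q0).
have prod0 (f u : J -> R) : 0 <= \prod_j f j `^ u j.
  by apply: prodr_ge0 => j _; exact: powR_ge0.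
have sum0 (u : J -> R) : 0 <= \sum_(s in S) \prod_j F j s `^ u j.
  exact: sumr_ge0.
apply: le_trans (Hoelder_sum _ _ _ t01) _ => //.
have -> : C `^ t * D `^ (1 - t) * r `^ (t * g + (1 - t) * h) *
    ((\prod_j N j `^ p j) `^ t * (\prod_j N j `^ q j) `^ (1 - t)) =
    (C * r `^ g * \prod_j N j `^ p j) `^ t *
    (D * r `^ h * \prod_j N j `^ q j) `^ (1 - t).
  rewrite !powRM ?mulr_ge0 ?powR_ge0 // -!powRrM [r `^ (_ + _)]powRD.
    by rewrite (mulrC t) (mulrC (1 - t)); ring.
  by apply/implyP => _; apply/lt0r_neq0; lra.
apply: ler_pM; rewrite ?powR_ge0 //; apply: ge0_ler_powR;
  rewrite ?nnegrE //; try lra; by rewrite !mulr_ge0 ?powR_ge0.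
Qed.
End discrete.

(** * Splitting along a subspace *)

Section splitting.
Context {R : realType}.

Lemma max_separated (X : finType) n m (A : 'M[R]_(n, m)) (K : R)
    (x : X -> 'rV[R]_n) (S : {set X}) (f : X -> R) :
  exists T : {set X}, [/\ T \subset S, mx_separated A K x T &
    forall S' : {set X}, S' \subset S -> mx_separated A K x S' ->
      \sum_(s in S') f s <= \sum_(s in T) f s].
Proof.
pose ok (T : {set X}) := (T \subset S) && `[< mx_separated A K x T >].
have ok0 : ok finset.set0.
  rewrite /ok finset.sub0set /=; apply/asboolP => s t; rewrite inE //.
case: (@Order.TotalTheory.arg_maxP _ _ _ finset.set0 ok (fun T => \sum_(s in T) f s) ok0).
move=> T /andP[TS /asboolP Tsep] Tmax; exists T; split=> // S' S'S S'sep.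
by apply: Tmax; rewrite /ok S'S; exact/asboolP.
Qed.

Lemma class_representative (X : finType) (T : eqType) (S : {set X}) (a : X -> T) :
  exists rep : X -> X,
    (forall s, s \in S -> rep s \in S /\ a (rep s) = a s) /\
    (forall s t, s \in S -> a s = a t -> rep s = rep t).
Proof.
exists (fun s => odflt s [pick t in S | a t == a s]); split=> [s sS|s t sS st].
  by case: pickP => [t /andP[tS /eqP //]|/(_ s)]; rewrite sS eqxx.
rewrite st; case: pickP => // /(_ s); by rewrite sS st eqxx.
Qed.

(** Think of the row space of [B] as a subspace [V], with coordinates
[x |-> x *m P] along [V] and [x |-> x *m Q] transverse to it; right multiplication
by [D j] kills the image of [V], so [B' *m A j *m D j] is the map induced on
quotients.  Points are grouped in cells according to the integer part of the transverse
coordinate.  The inner hypothesis bounds the sum over a cell.  The cells, placed at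
these integer parts, form a configuration for the outer hypothesis, in which a cell has
as weight its largest sum over a separated subset. *)
Lemma discrete_BL_split (J : finType) n k l (d : J -> nat)
    (A : forall j, 'M[R]_(n, d j)) (p : J -> R) (g h : R)
    (B : 'M[R]_(k, n)) (P : 'M[R]_(n, k)) (B' : 'M[R]_(l, n)) (Q : 'M[R]_(n, l))
    (D : forall j, 'M[R]_(d j)) :
  (forall j, 0 <= p j) -> P *m B + Q *m B' = 1%:M ->
  (forall j, B *m A j *m D j = 0) ->
  discrete_BL (fun j => B *m A j) p g ->
  discrete_BL (fun j => B' *m A j *m D j) p h ->
  discrete_BL A p (g + h).
Proof.
move=> p0 PBQ BAD inner outer K phi K0.
have split_vec (v : 'rV[R]_n) : v = v *m P *m B + v *m Q *m B'.
  by rewrite -!mulmxA -mulmxDr PBQ mulmx1.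
(* [phi1], [K1] and [K2] absorb the error made by replacing a point of a cell by
its projection, which stays within bounded distance of it; [phi2] bounds the number
of lattice points in a box. *)
pose phi1 K' := phi (mxl1 B * K' + mxl1 B' * 1).
pose K1 := K + \sum_j mxl1 (B' *m A j) * 1.
have K10 : 0 <= K1 by rewrite addr_ge0 // sumr_ge0 // => j _; rewrite mulr1 mxl1_ge0.
pose phi2 (K' : R) := ((Num.truncn (2 * K' + 1)).+1 ^ l * 1)%N.
pose K2 := \sum_j (mxl1 (D j) * K + mxl1 (B' *m A j *m D j) * 2).
have K20 : 0 <= K2.
  by apply: sumr_ge0 => j _; rewrite addr_ge0 // mulr_ge0 // mxl1_ge0.
have [C1 C10 {}inner] := inner K1 phi1 K10.
have [C2 C20 {}outer] := outer K2 phi2 K20.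
pose c1 := mxl1 P * 2 + 1; pose c2 := mxl1 Q + 1.
have [cP cQ] := (mxl1_ge0 P, mxl1_ge0 Q).
have c11 : 1 <= c1 by rewrite /c1; lra.
have c21 : 1 <= c2 by rewrite /c2; lra.
exists (C1 * c1 `^ g * (C2 * c2 `^ h)); first by rewrite !mulr_ge0 ?powR_ge0.
move=> X S x r F N r1 spS xr F0 N0 FN.
pose a s := mxfloor (x s *m Q).
have [rep [repS repE]] := class_representative S a.
pose U := (rep @: S)%SET; pose cell u := [set s in S | rep s == u]%SET.
have US u : u \in U -> u \in S by move=> /imsetP[s sS ->]; have [] := repS s sS.
have cellS u : cell u \subset S by apply/fintype.subsetP => s; rewrite inE => /andP[].
have cellQ u s : s \in cell u -> a s = a u.
  by rewrite inE => /andP[sS /eqP <-]; have [_ ->] := repS s sS.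
have cell_near u s t : s \in cell u -> t \in cell u -> inbox 1 ((x s - x t) *m Q).
  move=> su tu; rewrite mulmxBl; apply: inbox_same_floor.
  by rewrite -/(a s) -/(a t) (cellQ _ _ su) (cellQ _ _ tu).
have U_in_cell u : u \in U -> u \in cell u.
  move=> uU; rewrite inE US //=; move: uU => /imsetP[s sS ->].
  by have [rS ra] := repS s sS; rewrite (repE _ _ rS ra).
have /choice[T HT] : forall uj : X * J, exists T : {set X},
    [/\ T \subset cell uj.1, mx_separated (A uj.2) K x T &
    forall S' : {set X}, S' \subset cell uj.1 -> mx_separated (A uj.2) K x S' ->
      \sum_(s in S') F uj.2 s <= \sum_(s in T) F uj.2 s].
  by move=> uj; exact: max_separated.
pose G j u := \sum_(s in T (u, j)) F j s.
have G0 j u : 0 <= G j u by exact: sumr_ge0.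
have inner_bound u : u \in U -> \sum_(s in cell u) \prod_j F j s `^ p j <=
    C1 * c1 `^ g * r `^ g * \prod_j G j u `^ p j.
  move=> uU; have uu := U_in_cell _ uU.
  pose z s := (x s - x u) *m P.
  have zE s t : x s - x t = (z s - z t) *m B + (x s - x t) *m Q *m B'.
    by rewrite {1}[x s - x t]split_vec -mulmxBl opprB addrA subrK.
  have zu : z u = 0 by rewrite /z subrr mul0mx.
  rewrite -(mulrA C1) -powRM; try by lra.
  apply: (inner X (cell u) z (c1 * r) F (G^~ u)) => //.
  - by rewrite -[1]mulr1 ler_pM.
  - move=> b K' K'0; apply: leq_trans (spS (x u + b *m B) _ _); last first.
      by rewrite addr_ge0 // mulr_ge0 // mxl1_ge0.
    apply: subset_leq_card; apply/fintype.subsetP => s.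
    rewrite !inE => /andP[/andP[sS /eqP su] sz].
    have scell : s \in cell u by rewrite inE sS su eqxx.
    rewrite sS /= opprD addrA zE.
    have -> : (z s - z u) *m B + (x s - x u) *m Q *m B' - b *m B =
        (z s - b) *m B + (x s - x u) *m Q *m B'.
      by rewrite zu subr0 addrAC -mulmxBl.
    apply: inboxD; first exact: inboxM.
    by apply: inboxM => //; exact: cell_near scell uu.
  - move=> s sc.
    apply: (@inbox_le _ _ (mxl1 P * (r + r))); first by rewrite /c1; nra.
    apply: inboxM; first lra.
    by apply: inboxB; apply: xr; [exact: (fintype.subsetP (cellS u))|exact: US].
  - move=> j S' S'c S'sep; have [_ _] := HT (u, j); apply=> //= s t sS' tS' st.
    have := S'sep s t sS' tS' st; apply: contra => xst.
    have [sc tc] := (fintype.subsetP S'c _ sS', fintype.subsetP S'c _ tS').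
    have -> : (z s - z t) *m (B *m A j) =
        (x s - x t) *m A j - (x s - x t) *m Q *m (B' *m A j).
      by rewrite [X in _ = X *m A j - _](zE s t) [X in _ = X - _]mulmxDl -!mulmxA addrK.
    apply: (@inbox_le _ _ (K + mxl1 (B' *m A j) * 1)).
      rewrite lerD2l (bigD1 j) //= lerDl sumr_ge0 // => i _.
      by rewrite mulr1 mxl1_ge0.
    by apply: inboxB => //; apply: inboxM => //; exact: cell_near sc tc.
pose y u : 'rV[R]_l := mxz (a u).
have yE u v : (y u - y v) = (x u - x v) *m Q -
    ((x u *m Q - y u) - (x v *m Q - y v)).
  by rewrite mulmxBl opprB addrA subrKA opprB addrC subrKA.
have yQ u : inbox 1 (x u *m Q - y u) by exact: inbox_floor.
have outer_bound : \sum_(u in U) \prod_j G j u `^ p j <=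
    C2 * c2 `^ h * r `^ h * \prod_j N j `^ p j.
  rewrite -(mulrA C2) -powRM; try by lra.
  apply: (outer X U y (c2 * r) G N) => //.
  - by rewrite -[1]mulr1 ler_pM.
  - move=> b K' K'0; apply: (@card_box _ _ _ _ a b) => //.
      by move=> s; rewrite inE => /andP[].
    move=> v; apply/card_le1_eqP => s t; rewrite !inE.
    move=> /andP[/andP[sU _] /eqP sv] /andP[/andP[tU _] /eqP tv].
    have repU u : u \in U -> rep u = u.
      by move=> /U_in_cell; rewrite inE => /andP[_ /eqP].
    by rewrite -(repU s) // -(repU t) // (repE s t) ?US // sv tv.
  - move=> u uU; rewrite -[y u](subKr (x u *m Q)).
    apply: (@inbox_le _ _ (mxl1 Q * r + 1)); first by rewrite /c2; nra.
    by apply: inboxB => //; apply: inboxM; [lra|apply: xr; exact: US].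
  (* Best separated subsets of cells that are far apart in the quotient unite to
     a separated set, so the total is bounded by [N j] with no loss. *)
  - move=> j U' U'U U'sep.
    pose S' := (\bigcup_(u in U') T (u, j))%SET.
    have S'P s : reflect (exists2 u, u \in U' & s \in T (u, j)) (s \in S').
      exact: finset.bigcupP.
    have Tcell u : T (u, j) \subset cell u by have [] := HT (u, j).
    have Trep u s : s \in T (u, j) -> rep s = u.
      by move=> /(fintype.subsetP (Tcell u)); rewrite inE => /andP[_ /eqP].
    have -> : \sum_(u in U') G j u = \sum_(s in S') F j s.
      rewrite [RHS](partition_big rep (mem U')) /=; last first.
        by move=> s /S'P[u uU' /Trep ->].
      apply: eq_bigr => u uU'; apply: eq_bigl => s; apply/idP/andP.
        by move=> sT; rewrite (Trep _ _ sT) eqxx; split=> //; apply/S'P; exists u.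
      by case=> /S'P[v vU' sT] /eqP; rewrite (Trep _ _ sT) => <-.
    apply: FN.
      apply/fintype.subsetP => s /S'P[u uU' sT].
      exact: (fintype.subsetP (cellS u)) (fintype.subsetP (Tcell u) _ sT).
    move=> s t /S'P[u uU' su] /S'P[v vU' tv] st.
    have [uv|uv] := eqVneq u v.
      by move: uv su => -> sv; have [_ sep _] := HT (v, j); exact: sep.
    have := U'sep u v uU' vU' uv; apply: contra => xst.
    have aE w q : q \in T (w, j) -> y w = y q.
      by move=> /(fintype.subsetP (Tcell w)) /cellQ; rewrite /y => ->.
    rewrite (aE _ _ su) (aE _ _ tv) yE mulmxBl.
    apply: (@inbox_le _ _ (mxl1 (D j) * K + mxl1 (B' *m A j *m D j) * 2)).
      rewrite /K2 (bigD1 j) //= lerDl sumr_ge0 // => i _.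
      by rewrite addr_ge0 // mulr_ge0 // mxl1_ge0.
    apply: inboxB.
      have -> : (x s - x t) *m Q *m (B' *m A j *m D j) = (x s - x t) *m A j *m D j.
        move: (x s - x t) => w; rewrite [in RHS](split_vec w) !mulmxDl -!mulmxA.
        by rewrite (mulmxA B) BAD !mulmx0 add0r.
      exact: inboxM.
    apply: inboxM => //; have -> : 2 = 1 + 1 :> R by lra.
    exact: inboxB.
rewrite (partition_big_imset rep) /=.
have -> : \sum_(u in (rep @: S)%SET) \sum_(s in S | rep s == u) \prod_j F j s `^ p j
    = \sum_(u in U) \sum_(s in cell u) \prod_j F j s `^ p j.
  by apply: eq_bigr => u _; apply: eq_bigl => s; rewrite inE.
apply: le_trans (ler_sum _ inner_bound) _; rewrite -mulr_sumr.
apply: (@le_trans _ _ (C1 * c1 `^ g * r `^ g *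
    (C2 * c2 `^ h * r `^ h * \prod_j N j `^ p j))).
  by rewrite ler_wpM2l // !mulr_ge0 ?powR_ge0.
rewrite [r `^ (g + h)]powRD; last by apply/implyP => _; apply/lt0r_neq0; lra.
by rewrite le_eqVlt; apply/orP; left; apply/eqP; ring.
Qed.
End splitting.

(** * Polytopes and rank conditions *)

Section polytope.
Context {R : realType}.

(** A point that is not a vertex lies inside a segment of the polytope; extending the
segment in both directions until a new constraint becomes tight writes the point as
a convex combination of two points with fewer slack constraints.  Both extensions stop
because no nonzero direction [v] has all [L i v <= 0]. *)
Lemma polytope_ind (K : Type) (I : finType) (L : I -> (K -> R) -> R) (b : I -> R)
    (Q : (K -> R) -> Prop) (P := fun z => forall i, L i z <= b i) :
  (forall i z v (t : R), L i (fun k => z k + t * v k) = L i z + t * L i v) ->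
  (forall v, (forall i, L i v <= 0) -> forall k, v k = 0) ->
  (forall z w (t : R), 0 < t < 1 -> P z -> P w -> Q z -> Q w ->
     Q (fun k => t * z k + (1 - t) * w k)) ->
  (forall z, P z ->
     (forall v, (forall i, L i z = b i -> L i v = 0) -> forall k, v k = 0) -> Q z) ->
  forall z, P z -> Q z.
Proof.
move=> Llin Lbnd Qconv Qvert.
pose slack z := [set i | L i z != b i]%SET.
move=> z; have [m] := ubnP #|slack z|; elim: m z => // m IHm z zm Pz.
have [kill|] := pselect (forall v,
    (forall i, L i z = b i -> L i v = 0) -> forall k, v k = 0).
  exact: Qvert.
move=> /existsNP[v /not_implyP[vtight /existsNP[k0 /eqP vk0]]].
have move_to w : (forall i, L i z = b i -> L i w = 0) -> w k0 != 0 ->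
    exists2 t : R, 0 < t & P (fun k => z k + t * w k) /\
      (#|slack (fun k => (z k + t * w k)%R)| < m)%N.
  move=> wtight wk0.
  have [i0 Li0] : exists i, 0 < L i w.
    apply: contrapT => /forallNP no; move/eqP: wk0; apply; apply: Lbnd => i.
    by rewrite leNgt; apply/negP; exact: no.
  (* The time at which constraint [i] becomes tight along [w]. *)
  pose ratio i := (b i - L i z) / L i w.
  case: (@Order.TotalTheory.arg_minP _ _ _ i0 (fun i => 0 < L i w) ratio Li0) => i Li imin.
  have nt i' : 0 < L i' w -> L i' z < b i'.
    move=> Li'; rewrite lt_neqAle Pz andbT; apply/eqP => /wtight Le.
    by rewrite Le ltxx in Li'.
  exists (ratio i); first by rewrite divr_gt0 // subr_gt0 nt.
  have t0 : 0 < ratio i by rewrite divr_gt0 // subr_gt0 nt.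
  split.
    move=> i'; rewrite Llin; have [Li'|Li'] := ltP 0 (L i' w).
      have := imin i' Li'; rewrite {2}/ratio ler_pdivlMr //; lra.
    have := Pz i'; nra.
  apply: (leq_trans _ (zm : #|slack z| <= m)%N); apply: proper_card.
  apply/properP; split.
    apply/fintype.subsetP => i'; rewrite !inE Llin; apply: contra => /eqP e.
    by rewrite wtight // e mulr0 addr0.
  exists i; rewrite !inE; first by rewrite lt_eqF // nt.
  by rewrite Llin negbK divfK ?lt0r_neq0 // addrC subrK.
have L0 i : L i (fun=> 0) = 0.
  have := Llin i (fun=> 0) (fun=> 0) 1.
  have -> : (fun _ : K => 0 + 1 * 0) = (fun=> 0) :> (K -> R) by apply/funext => k; lra.
  lra.
have LN i w : L i (fun k => - w k) = - L i w.
  have := Llin i (fun=> 0) w (-1); rewrite L0.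
  have -> : (fun k : K => 0 + -1 * w k) = (fun k => - w k) by apply/funext => k; lra.
  lra.
have [t t0 [Pt tm]] := move_to v vtight vk0.
have Nvtight i : L i z = b i -> L i (fun k => - v k) = 0.
  by move=> /vtight; rewrite LN => ->; rewrite oppr0.
have Nvk0 : - v k0 != 0 by rewrite oppr_eq0.
have [s s0 [Ps sm]] := move_to (fun k => - v k) Nvtight Nvk0.
have -> : z = (fun k => s / (s + t) * (z k + t * v k) +
     (1 - s / (s + t)) * (z k + s * - v k)).
  by apply/funext => k; field; lra.
apply: Qconv; [|exact: Pt|exact: Ps|exact: IHm|exact: IHm].
rewrite divr_gt0 ?ltr_pdivrMr //; lra.
Qed.

End polytope.

Section rank_condition.
Context {R : realType}.

(** The row space of [V] stands for a subspace of dimension [\rank V], and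
[V *m A j] for its image under the [j]-th map. *)
Definition rank_condition (J : finType) n (d : J -> nat)
    (A : forall j, 'M[R]_(n, d j)) (p : J -> R) (g : R) :=
  forall m (V : 'M[R]_(m, n)),
    (\rank V)%:R - \sum_j p j * (\rank (V *m A j))%:R <= g.

Lemma discrete_BL_le (J : finType) n (d : J -> nat)
    (A : forall j, 'M[R]_(n, d j)) (p : J -> R) (g h : R) :
  g <= h -> discrete_BL A p g -> discrete_BL A p h.
Proof.
move=> gh Ag K phi K0; have [C C0 {}Ag] := Ag K phi K0.
exists C => // X S x r F N r1 spS xr F0 N0 FN.
apply: le_trans (Ag X S x r F N r1 spS xr F0 N0 FN) _.
apply: ler_wpM2r; first by apply: prodr_ge0 => j _; exact: powR_ge0.
by rewrite ler_wpM2l // ler_powR.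
Qed.

Lemma rank_condition_restrict (J : finType) n k (d : J -> nat)
    (A : forall j, 'M[R]_(n, d j)) (p : J -> R) (g : R) (B : 'M[R]_(k, n)) :
  row_free B -> rank_condition A p g -> rank_condition (fun j => B *m A j) p g.
Proof.
move=> Bfree Ag m W; rewrite -(mxrankMfree W Bfree).
by under eq_bigr do rewrite mulmxA; exact: Ag.
Qed.

(** Multiplication by [D] is the projection modulo the image of [V], so this is
additivity of dimension for the image of [W + V]. *)
Lemma rank_quotient n k l m (V : 'M[R]_(k, n)) (W : 'M[R]_(l, n)) (A : 'M[R]_(n, m))
    (D := cokermx (V *m A)) :
  (\rank (W *m A *m D) + \rank (V *m A) = \rank ((W + V)%MS *m A))%N.
Proof.
have VWA : (V *m A <= (W + V)%MS *m A)%MS by rewrite submxMr // addsmxSr.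
have kerD : (kermx D == V *m A)%MS.
  apply/andP; split; last by apply/sub_kermxP; rewrite /D mulmx_coker.
  by rewrite submxE -/D mulmx_ker.
have VAD : V *m A *m D = 0 by exact: mulmx_coker.
clearbody D; rewrite -(mxrank_mul_ker ((W + V)%MS *m A) D); congr (_ + _)%N.
  apply/eqP; rewrite eqn_leq; apply/andP; split; apply: mxrankS.
    by rewrite -!mulmxA submxMr // addsmxSl.
  rewrite -mulmxA addsmxMr addsmx_sub !mulmxA submx_refl /=.
  by rewrite VAD sub0mx.
apply: esym; apply/eqP; rewrite eqn_leq; apply/andP; split; apply: mxrankS.
  by rewrite (submx_trans (capmxSr _ _)) // (eqmxP kerD).
by rewrite sub_capmx VWA (eqmxP kerD) submx_refl.
Qed.

End rank_condition.

(** * The rank condition implies the discrete inequality *)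

Section upper_discrete.
Context {R : realType}.

(** The last hypothesis says that the quotient by [V] satisfies the rank condition
with exponent [0]. *)
Lemma discrete_BL_split_at (J : finType) n (d : J -> nat)
    (A : forall j, 'M[R]_(n, d j)) (p : J -> R) (g : R) (V : 'M[R]_n) :
  (forall j, 0 <= p j) ->
  (forall k (B : forall j, 'M[R]_(k, d j)) h, (k < n)%N ->
     rank_condition B p h -> discrete_BL B p h) ->
  (0 < \rank V < n)%N -> rank_condition A p g ->
  (forall m (W : 'M[R]_(m, n)), (V <= W)%MS ->
     (\rank W)%:R - \sum_j p j * (\rank (W *m A j))%:R <=
     (\rank V)%:R - \sum_j p j * (\rank (V *m A j))%:R) ->
  discrete_BL A p g.
Proof.
move=> p0 IH /andP[V0 Vn] Ag above.
pose B := row_base V; pose B' := row_base (V^C)%MS.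
have /sub_addsmxP[[P Q] /= PBQ] : (1%:M <= B + B')%MS.
  by rewrite (adds_eqmx (eq_row_base _) (eq_row_base _)) sub1mx addsmx_compl_full.
have BV j : \rank (B *m A j) = \rank (V *m A j).
  by rewrite (eqmxMr _ (eq_row_base V)).
rewrite -[g]addr0.
apply: (@discrete_BL_split R J n _ _ d A p g 0 B P B' Q
  (fun j => cokermx (B *m A j)) p0 (esym PBQ) (fun j => mulmx_coker _)).
  apply: IH => //.
  by apply: rank_condition_restrict Ag; exact: row_base_free.
apply: IH; first by rewrite mxrank_compl ltn_subrL V0 (leq_trans V0) // ltnW.
move=> m W.
have B'free : row_free B' by exact: row_base_free.
have rW : \rank (W *m B' + B)%MS = (\rank W + \rank V)%N.
  rewrite mxrank_disjoint_sum ?mxrankMfree ?eq_row_base //.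
  apply/eqP; rewrite -submx0 -(capmx_compl V) capmxC; apply: capmxS.
    by rewrite eq_row_base.
  by apply: submx_trans (submxMl _ _) _; rewrite eq_row_base.
have VWB : (V <= W *m B' + B)%MS.
  by apply: submx_trans (addsmxSr _ _); rewrite eq_row_base.
have := above _ _ VWB; rewrite rW natrD.
have -> : \sum_j p j * (\rank ((W *m B' + B)%MS *m A j))%:R =
    \sum_j p j * (\rank (W *m (B' *m A j *m cokermx (B *m A j))))%:R +
    \sum_j p j * (\rank (V *m A j))%:R.
  rewrite -big_split /=; apply: eq_bigr => j _.
  by rewrite -rank_quotient natrD mulrDr BV !mulmxA.
lra.
Qed.

(** Here [(v, w)] is a direction in the space of pairs [(p, g)], and the last
hypothesis says that only the zero direction is annihilated by the constraints
that are tight at [(p, g)], that is, that [(p, g)] is a vertex. *)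
Lemma discrete_BL_vertex (J : finType) n (d : J -> nat)
    (A : forall j, 'M[R]_(n, d j)) (p : J -> R) (g : R) :
  (forall k (B : forall j, 'M[R]_(k, d j)) h, (k < n)%N ->
     rank_condition B p h -> discrete_BL B p h) ->
  (forall j, 0 <= p j <= 1) -> g <= n%:R -> rank_condition A p g ->
  (forall (v : J -> R) (w : R), (forall j, p j = 0 -> v j = 0) ->
     (forall j, p j = 1 -> v j = 0) -> (g = n%:R -> w = 0) ->
     (forall V : 'M[R]_n, (\rank V)%:R - \sum_j p j * (\rank (V *m A j))%:R = g ->
        w + \sum_j v j * (\rank (V *m A j))%:R = 0) ->
     w = 0 /\ forall j, v j = 0) ->
  discrete_BL A p g.
Proof.
move=> IH p01 gn Ag kill.
have p0 j : 0 <= p j by case/andP: (p01 j).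
have p1 j : p j <= 1 by case/andP: (p01 j).
have g0 : 0 <= g.
  have := Ag _ (0 : 'M[R]_n); rewrite mxrank0 big1 ?subr0 // => j _.
  by rewrite mul0mx mxrank0 mulr0.
have [gE|gn'] := eqVneq g n%:R; first by apply: discrete_BL_full => //; rewrite gE.
have ltgn : g < n%:R by rewrite lt_neqAle gn'.
have [[V [Vr Vt]]|notight] := pselect (exists V : 'M[R]_n, (0 < \rank V < n)%N /\
    (\rank V)%:R - \sum_j p j * (\rank (V *m A j))%:R = g).
  by apply: (discrete_BL_split_at p0 IH Vr Ag) => m W _; rewrite Vt; exact: Ag.
have [[i [pi1 Ai]]|no1] := pselect (exists i, p i = 1 /\ A i != 0).
  pose V := kermx (A i).
  have [V0|V0] := eqVneq (\rank V) 0%N.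
    apply: (discrete_BL_injective p0 g0 pi1).
    by rewrite -kermx_eq0 -mxrank_eq0 -/V V0.
  have rV : (\rank V = n - \rank (A i))%N by rewrite mxrank_ker.
  have VAi : V *m A i = 0 by exact: mulmx_ker.
  apply: (discrete_BL_split_at p0 IH _ Ag (V := V)).
    rewrite lt0n V0 /= rV ltn_subrL lt0n mxrank_eq0 Ai /=.
    by rewrite -(ltr_nat R); apply: le_lt_trans ltgn.
  move=> m W VW; rewrite (bigD1 i) //= [in leRHS](bigD1 i) //= pi1 !mul1r VAi mxrank0.
  have : (\rank W)%:R = (\rank (W *m A i))%:R + (\rank V)%:R :> R.
    rewrite -natrD -(mxrank_mul_ker W (A i)); congr (_ + _)%:R.
    apply/eqP; rewrite eqn_leq; apply/andP; split; apply: mxrankS.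
      by rewrite capmxSr.
    by rewrite sub_capmx VW submx_refl.
  have : \sum_(j | j != i) p j * (\rank (V *m A j))%:R <=
         \sum_(j | j != i) p j * (\rank (W *m A j))%:R.
    apply: ler_sum => j _; rewrite ler_wpM2l // ler_nat mxrankS //.
    exact: submxMr.
  lra.
exfalso.
(* From here on a tight subspace is zero or the whole space; a nonzero direction annihilated by the
constraints is exhibited in every remaining case. *)
have tight_cases (V : 'M[R]_n) : (\rank V)%:R - \sum_j p j * (\rank (V *m A j))%:R = g ->
    (forall j, \rank (V *m A j) = 0%N) /\ g = 0 \/
    (forall j, \rank (V *m A j) = \rank (A j)) /\
    n%:R - \sum_j p j * (\rank (A j))%:R = g.
  move=> Vt; have [V0|V0] := posnP (\rank V).
    left; have {}V0 : V = 0 by apply/eqP; rewrite -mxrank_eq0 V0.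
    have e j : \rank (V *m A j) = 0%N by rewrite V0 mul0mx mxrank0.
    split=> //; rewrite -Vt V0 mxrank0 big1 ?subrr // => j _.
    by rewrite mul0mx mxrank0 mulr0.
  have Vn : \rank V = n.
    apply/eqP; rewrite eqn_leq rank_leq_row leqNgt; apply/negP => Vn.
    by apply: notight; exists V; rewrite V0 Vn.
  have e j : \rank (V *m A j) = \rank (A j).
    by rewrite (eqmxMfull (A j)) // /row_full Vn.
  by right; split=> //; rewrite -Vt Vn; under [in RHS]eq_bigr do rewrite e.
pose inner j := (0 < p j < 1).
have not_inner j : ~~ inner j -> p j = 0 \/ p j = 1 /\ A j = 0.
  move=> nj; have [pj1|pj1] := eqVneq (p j) 1.
    by right; split=> //; apply/eqP/negP => /negP Aj; apply: no1; exists j.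
  left; apply/eqP; rewrite eq_le p0 andbT leNgt; apply: contra nj => pj.
  by rewrite /inner pj lt_neqAle pj1 p1.
have killed (v : J -> R) (w : R) : (forall j, ~~ inner j -> v j = 0) ->
    (g = 0 -> w = 0) ->
    (n%:R - \sum_j p j * (\rank (A j))%:R = g ->
       w + \sum_j v j * (\rank (A j))%:R = 0) ->
    forall j, v j = 0.
  move=> vout w0 wn; have [||||_ //] := kill v w.
  - by move=> j pj; apply: vout; rewrite /inner pj ltxx.
  - by move=> j pj; apply: vout; rewrite /inner pj ltxx andbF.
  - by move=> /eqP; rewrite (negPf gn').
  - move=> V /tight_cases[[e gz]|[e ge]].
      by rewrite w0 // big1 ?addr0 // => j _; rewrite e mulr0.
    by under eq_bigr do rewrite e; exact: wn.
have inner_neq0 i : inner i -> (0 : R) < (\rank (A i))%:R.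
  move=> ii; rewrite ltr0n lt0n; apply/eqP => Ai.
  have /(_ _ _ _ i) := killed (fun j => (j == i)%:R) 0; rewrite eqxx.
  move=> /= absurd; suff : (1 : R) = 0 by move/eqP; rewrite oner_eq0.
  apply: absurd => // [j nj|_].
    by case: eqP nj => // ->; rewrite ii.
  rewrite (bigD1 i) //= eqxx Ai mulr0 !add0r big1 // => j /negPf ->.
  by rewrite mul0r.
(* Two fractional exponents can be traded against each other keeping
[\sum_j p_j * rank A_j] unchanged. *)
have inner_uniq i k : inner i -> inner k -> i = k.
  move=> ii ik; apply/eqP/negP => /negP nik.
  pose v j : R := if j == i then (\rank (A k))%:R else
                  if j == k then - (\rank (A i))%:R else 0.
  have : v i = 0.
    apply: (killed v 0) => // [j nj|_].
      rewrite /v; case: eqP nj => [->|_]; first by rewrite ii.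
      by case: eqP => // ->; rewrite ik.
    rewrite add0r (bigD1 i) //= (bigD1 k) 1?eq_sym //= big1 => [|j /andP[ji jk]].
      by rewrite /v !eqxx eq_sym (negPf nik); ring.
    by rewrite /v (negPf ji) (negPf jk) mul0r.
  by rewrite /v eqxx => e; have := inner_neq0 _ ik; rewrite e ltxx.
have out0 j : ~~ inner j -> p j * (\rank (A j))%:R = 0.
  by move=> /not_inner[->|[_ ->]]; rewrite ?mul0r // mxrank0 mulr0.
have Agn : n%:R - \sum_j p j * (\rank (A j))%:R <= g.
  have := Ag _ 1%:M; rewrite mxrank1; under eq_bigr do rewrite mul1mx; exact.
have [i ii|none] := pickP inner; last first.
  move: Agn; rewrite big1 ?subr0 => [ng|j _]; last by rewrite out0 // none.
  by move: ltgn; rewrite ltNge ng.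
have sum_i (u : J -> R) : (forall j, ~~ inner j -> u j = 0) -> \sum_j u j = u i.
  move=> u0; rewrite (bigD1 i) //= big1 ?addr0 // => j ji; apply: u0.
  by apply: contra ji => /inner_uniq/(_ ii)/eqP.
rewrite (sum_i _ out0) in Agn.
(* With a single fractional exponent [p i], increase it and decrease [g] so as to
keep the constraint of the whole space tight, unless [g = 0]; in that case the whole
space is not tight, since [p i * rank A_i < n]. *)
have /(_ _ _ _ i) := killed (fun j => (j == i)%:R)
  (if g == 0 then 0 else - (\rank (A i))%:R).
rewrite eqxx => absurd; suff : (1 : R) = 0 by move/eqP; rewrite oner_eq0.
apply: absurd => [j nj|->|].
- by case: eqP nj => // ->; rewrite ii.
- by rewrite eqxx.
rewrite (sum_i _ out0) sum_i => [|j nj]; last first.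
  by case: eqP nj => [->|_]; rewrite ?ii // mul0r.
rewrite eqxx mul1r; case: eqP => [gz|_ _]; last by rewrite addNr.
have /andP[pi0 pi1] := ii.
have : (\rank (A i))%:R <= n%:R :> R by rewrite ler_nat rank_leq_row.
have := inner_neq0 _ ii; nra.
Qed.

Lemma discrete_BL_of_rank_condition (J : finType) n (d : J -> nat)
    (A : forall j, 'M[R]_(n, d j)) (p : J -> R) (g : R) :
  (forall j, 0 <= p j <= 1) -> rank_condition A p g -> discrete_BL A p g.
Proof.
elim/ltn_ind: n d A p g => n IHn d A p g p01 Ag.
wlog gn : g Ag / g <= n%:R.
  move=> wl; have [|/ltW ng] := leP g n%:R; first exact: wl.
  apply: (discrete_BL_le ng); apply: wl => // m V.
  apply: (@le_trans _ _ (\rank V)%:R); last by rewrite ler_nat rank_leq_col.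
  rewrite gerBl sumr_ge0 // => j _; rewrite mulr_ge0 //.
  by case/andP: (p01 j).
(* Finitely many constraints suffice, one for each tuple of ranks; tuples that no
subspace realizes are multiplied by zero. *)
pose profile := ('I_n.+1 * {ffun J -> 'I_n.+1})%type.
pose realized (f : profile) := `[< exists V : 'M[R]_n,
  \rank V = f.1 /\ forall j, \rank (V *m A j) = f.2 j >].
pose I := ((J + J) + (unit + profile))%type.
pose L (i : I) (z : option J -> R) : R := match i with
  | inl (inl j) => - z (Some j)
  | inl (inr j) => z (Some j)
  | inr (inl _) => z None
  | inr (inr f) =>
      (realized f)%:R * (- z None - \sum_j z (Some j) * (f.2 j)%:R)
  end.
pose b (i : I) : R := match i with
  | inl (inl j) => 0
  | inl (inr j) => 1
  | inr (inl _) => n%:R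
  | inr (inr f) => (realized f)%:R * - (f.1)%:R
  end.
pose z0 (k : option J) := if k is Some j then p j else g.
pose rank_lt (V : 'M[R]_n) : (\rank V < n.+1)%N := rank_leq_row V.
have rank_ltA (V : 'M[R]_n) j : (\rank (V *m A j) < n.+1)%N.
  by rewrite ltnS (leq_trans (mxrankM_maxl _ _)) // rank_leq_row.
pose prof (V : 'M[R]_n) : profile :=
  (Ordinal (rank_lt V), [ffun j => Ordinal (rank_ltA V j)]).
have profP V : realized (prof V).
  by apply/asboolP; exists V; split=> // j; rewrite ffunE.
pose Q (z : option J -> R) := discrete_BL A (fun j => z (Some j)) (z None).
have Pcond z : (forall i, L i z <= b i) ->
    [/\ forall j, 0 <= z (Some j) <= 1, z None <= n%:R &
        rank_condition A (fun j => z (Some j)) (z None)].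
  move=> Pz; split=> [j||m V].
  - by rewrite -oppr_le0 (Pz (inl (inl j))) (Pz (inl (inr j))).
  - exact: (Pz (inr (inl tt))).
  have := Pz (inr (inr (prof <<V>>%MS))); rewrite /= profP !mul1r /= mxrank_gen.
  have -> : \sum_j z (Some j) * ((prof <<V>>%MS).2 j)%:R =
            \sum_j z (Some j) * (\rank (V *m A j))%:R.
    by apply: eq_bigr => j _; rewrite ffunE /= (eqmxMr _ (genmxE V)).
  lra.
suff : Q z0 by [].
apply: (@polytope_ind R (option J) I L b Q).
- move=> [[j|j]|[[]|f]] z v t /=; try by lra.
  have -> : \sum_j (z (Some j) + t * v (Some j)) * (f.2 j)%:R =
    \sum_j z (Some j) * (f.2 j)%:R + t * \sum_j v (Some j) * (f.2 j)%:R.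
    by rewrite mulr_sumr -big_split; apply: eq_bigr => j _ /=; ring.
  ring.
- move=> v Lv.
  have v0 j : v (Some j) = 0.
    by apply/eqP; rewrite eq_le -oppr_le0 (Lv (inl (inr j))) (Lv (inl (inl j))).
  case=> [j|]; first exact: v0.
  apply/eqP; rewrite eq_le (Lv (inr (inl tt))) /=.
  have := Lv (inr (inr (prof 0))); rewrite /= profP mul1r big1 ?subr0 ?oppr_le0 //.
  by move=> j _; rewrite v0 mul0r.
- move=> z w t t01 /Pcond[z01 _ _] /Pcond[w01 _ _]; apply: discrete_BL_convex => //.
    by move=> j; case/andP: (z01 j).
  by move=> j; case/andP: (w01 j).
- move=> z Pz kill; have [z01 zn zcond] := Pcond z Pz.
  apply: discrete_BL_vertex => // [k B h kn|v w v0 v1 wn vV].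
    by apply: IHn.
  pose u (k : option J) := if k is Some j then v j else w.
  have u0 : forall k, u k = 0.
    apply: kill => -[[j|j]|[[]|f]] /=.
    + by move=> /eqP; rewrite oppr_eq0 => /eqP /v0 ->; rewrite oppr0.
    + exact: v1.
    + exact: wn.
    case: (boolP (realized f)) => [/asboolP[V [V1 V2]]|_]; last by rewrite !mul0r.
    rewrite !mul1r => tight.
    have := vV V; rewrite V1.
    have e (y : J -> R) : \sum_j y j * (\rank (V *m A j))%:R =
        \sum_j y j * (f.2 j)%:R by apply: eq_bigr => j _; rewrite V2.
    rewrite !e; lra.
  by split=> [|j]; [exact: (u0 None)|exact: (u0 (Some j))].
- move=> [[j|j]|[[]|f]] /=.
  + by rewrite oppr_le0; case/andP: (p01 j).
  + by case/andP: (p01 j).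
  + exact: gn.
  case: (boolP (realized f)) => [/asboolP[V [V1 V2]]|_]; last by rewrite !mul0r.
  rewrite !mul1r; have := Ag _ V; rewrite V1.
  have -> : \sum_j p j * (\rank (V *m A j))%:R =
      \sum_j p j * (f.2 j)%:R by apply: eq_bigr => j _; rewrite V2.
  lra.
Qed.

End upper_discrete.

Local Open Scope classical_set_scope.
Local Open Scope ring_scope.

(** * Functions constant on unit cubes *)

Section cubes.
Context {R : realType}.

Lemma unit_cubeP n (v : 'rV[int]_n) (x : 'rV[R]_n) :
  unit_cube v x <-> mxfloor x = v.
Proof.
split=> [vx|<- i]; last first.
  by rewrite !mxE -[X in _ + X]/(1%:~R) -intrD floor_itv.
apply/rowP => i; rewrite mxE; apply/eqP; rewrite floor_eq intrD.
exact: vx.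
Qed.

Lemma unit_cubeE n (v : 'rV[int]_n) :
  unit_cube v = [set x : 'rV[R]_n |
    forall i, `[(v ord0 i)%:~R, (v ord0 i)%:~R + 1[%classic (x ord0 i)].
Proof. by apply/seteqP; split=> x vx i /=; have := vx i; rewrite /= in_itv. Qed.

Lemma measurable_unit_cube n (v : 'rV[int]_n) :
  measurable (unit_cube v : set 'rV[R]_n).
Proof.
rewrite unit_cubeE; apply: (@measurable_boxrV _ R _
  (fun i => `[(v ord0 i)%:~R, (v ord0 i)%:~R + 1[%classic)) => i.
exact: measurable_itv.
Qed.

Lemma leb_unit_cube n (v : 'rV[int]_n) : leb n (unit_cube v : set 'rV[R]_n) = 1%E.
Proof.
rewrite unit_cubeE (lebX (A := fun i => `[(v ord0 i)%:~R, (v ord0 i)%:~R + 1[%classic)).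
  rewrite big1 // => i _; rewrite lebesgue_measure_itv /= lte_fin ltrDl ltr01.
  by rewrite -EFinB addrC addKr.
by move=> i; exact: measurable_itv.
Qed.

Lemma trivIset_unit_cube n (T : choiceType) (D : set T) (v : T -> 'rV[int]_n) :
  {in D &, injective v} -> trivIset D (fun s => unit_cube (v s) : set 'rV[R]_n).
Proof.
move=> vI s t Ds Dt [x [/unit_cubeP xs /unit_cubeP xt]].
by apply: vI; rewrite ?inE // -xs.
Qed.

Lemma admissible_measurable m (f : 'rV[R]_m -> R) :
  BL_admissible f -> measurable_fun setT f.
Proof. by case=> /measurable_int /measurable_EFinP. Qed.

(** The points lie in distinct unit cubes, and [f y] is the integral of [f] over the
unit cube of [y]. *)
Lemma admissible_sum_le m (f : 'rV[R]_m -> R) (X : finType) (S : {set X})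
    (y : X -> 'rV[R]_m) :
  BL_admissible f -> {in S &, injective (fun s => mxfloor (y s))} ->
  (\sum_(s in S) (f (y s))%:E <= \int[leb m]_x (f x)%:E)%E.
Proof.
move=> fadm yI; have [_ _ f0 fc] := fadm.
have fE s : (f (y s))%:E = (\int[leb m]_(x in unit_cube (mxfloor (y s))) (f x)%:E)%E.
  rewrite (eq_integral (cst (f (y s))%:E)) => [|x /set_mem /= xs].
    rewrite integral_cst; last exact: measurable_unit_cube.
    by rewrite [X in (_ * X)%E](_ : _ = 1%E) ?mule1 //; exact: leb_unit_cube.
  by congr EFin; apply: fc xs _; exact/unit_cubeP.
under eq_bigr do rewrite fE.
rewrite -big_enum /= -ge0_integral_bigsetU //=.
- apply: ge0_subset_integral => //.
  + apply: bigsetU_measurable => s _. exact: measurable_unit_cube.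
  + by apply/measurable_EFinP; exact: admissible_measurable.
  + by move=> x _; rewrite lee_fin.
- by move=> s; exact: measurable_unit_cube.
- exact: enum_uniq.
- apply: trivIset_unit_cube => s t; rewrite !inE /= !mem_enum; exact: yI.
- apply/measurable_funTS/measurable_EFinP; exact: admissible_measurable.
- by move=> x _; rewrite lee_fin.
Qed.

Lemma admissible_le m (f : 'rV[R]_m -> R) (y : 'rV[R]_m) :
  BL_admissible f -> ((f y)%:E <= \int[leb m]_x (f x)%:E)%E.
Proof.
move=> fadm; have := @admissible_sum_le m f unit [set: unit]%SET (fun=> y) fadm.
rewrite (big_pred1 tt) => [|[]]; last by rewrite inE.
by apply=> [] [] [].
Qed.

Lemma admissible_integral m (f : 'rV[R]_m -> R) : BL_admissible f ->
  exists2 N : R, 0 < N & (\int[leb m]_x (f x)%:E)%E = N%:E.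
Proof.
move=> fadm; have [fint [x0 fx0] f0 fc] := fadm.
have fin : (\int[leb m]_x (f x)%:E)%E \is a fin_num by exact: integrable_fin_num.
exists (fine (\int[leb m]_x (f x)%:E)%E); last by rewrite fineK.
rewrite -lte_fin fineK //; apply: lt_le_trans (admissible_le x0 fadm).
by rewrite lte_fin lt_neqAle eq_sym fx0 f0.
Qed.

(** The factor two leaves room for a strict inequality: if [2 * h x < c] everywhere on
a set of measure one, the integral is at most [c / 2 < c]. *)
Lemma exists_half_average d (T : measurableType d) (mu : {measure set T -> \bar R})
    (D : set T) (h : T -> R) (M : R) :
  measurable D -> mu D = 1%E -> measurable_fun D h ->
  (forall x, D x -> 0 <= h x <= M) ->
  exists2 x, D x & (\int[mu]_(x in D) (h x)%:E <= (2 * h x)%:E)%E.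
Proof.
move=> mD D1 mh hM.
have mh' : measurable_fun D (EFin \o h) by exact/measurable_EFinP.
have h0 x : D x -> (0 <= (h x)%:E)%E by move=> /hM /andP[]; rewrite lee_fin.
have int_le (c : R) : (forall x, D x -> h x <= c) ->
    (\int[mu]_(x in D) (h x)%:E <= c%:E)%E.
  move=> hc; rewrite -[leRHS]mule1 -D1 -integral_cst //.
  exact: ge0_le_integral.
have I0 : (0 <= \int[mu]_(x in D) (h x)%:E)%E by exact: integral_ge0.
have IM : (\int[mu]_(x in D) (h x)%:E <= M%:E)%E by apply: int_le => x /hM /andP[].
have [c cE] : exists c, (\int[mu]_(x in D) (h x)%:E)%E = c%:E.
  exists (fine (\int[mu]_(x in D) (h x)%:E)%E); rewrite fineK // ge0_fin_numE //.
  exact: le_lt_trans IM (ltry _).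
rewrite cE in I0 *; rewrite lee_fin in I0.
have [x0 Dx0] : exists x, D x.
  apply/set0P; apply/eqP => D0; move: D1; rewrite D0 measure0 => /eqP.
  by rewrite eqe eq_sym oner_eq0.
apply: contrapT => no.
have small x : D x -> h x <= c / 2.
  move=> Dx; rewrite leNgt; apply/negP => cx; apply: no; exists x => //.
  rewrite lee_fin; lra.
have := int_le _ small; rewrite cE lee_fin => c2; apply: no; exists x0 => //.
by rewrite lee_fin; have /andP[] := hM _ Dx0; lra.
Qed.

Lemma measurable_mulmx n m (A : 'M[R]_(n, m)) :
  measurable_fun setT (fun x : 'rV[R]_n => x *m A : 'rV[R]_m).
Proof.
apply: measurable_fun_rVP => j.
rewrite (_ : (fun _ => _) = fun x : 'rV[R]_n => \sum_i x ord0 i * A i j); last first.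
  by apply/funext => x; rewrite mxE.
apply: measurable_sum => i; apply: measurable_funM => //.
exact: measurable_coord_rV.
Qed.

Lemma measurable_centered_box n (r : R) :
  measurable (centered_box r : set 'rV[R]_n).
Proof.
rewrite (_ : centered_box r = [set x : 'rV[R]_n | forall i, `[- r, r]%classic (x ord0 i)]).
  apply: (@measurable_boxrV _ R _ (fun=> `[- r, r]%classic)) => i.
  exact: measurable_itv.
by apply/seteqP; split=> x xr i; have := xr i; rewrite /= in_itv.
Qed.

End cubes.

(** * The upper bound *)

Section upper.
Context {R : realType}.

Lemma BL_denominator J (d : 'I_J -> nat) (p N : 'I_J -> R)
    (f : forall j, 'rV[R]_(d j) -> R) :
  (forall j, \int[leb (d j)]_y (f j y)%:E = (N j)%:E)%E ->
  (\prod_j (\int[leb (d j)]_y (f j y)%:E) `^ p j = (\prod_j N j `^ p j)%:E)%E.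
Proof.
by move=> fN; rewrite -prodEFin; apply: eq_bigr => j _; rewrite fN poweR_EFin.
Qed.

Definition grid_vector n (m : nat) (v : {ffun 'I_n -> 'I_(m + m).+1}) : 'rV[int]_n :=
  \row_i ((v i : nat)%:Z - m%:Z).

Lemma grid_vector_inj n m : injective (@grid_vector n m).
Proof.
move=> v w /rowP vw; apply/ffunP => i; apply/val_inj => /=.
have := vw i; rewrite !mxE => /addIr; by case.
Qed.

Lemma grid_vector_onto n m (x : 'rV[R]_n) : inbox m%:R x ->
  exists v : {ffun 'I_n -> 'I_(m + m).+1}, grid_vector v = mxfloor x.
Proof.
move=> /inboxP xm.
have xi i : - m%:Z <= Num.floor (x ord0 i) <= m%:Z.
  have := xm i; rewrite ler_norml => /andP[lo hi].
  apply/andP; split; first by rewrite floor_ge_int intrN.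
  by rewrite -(ler_int R); apply: le_trans hi; have /andP[] := floor_itv (x ord0 i).
exists [ffun i => inord (absz (Num.floor (x ord0 i) + m%:Z))].
apply/rowP => i; rewrite !mxE ffunE; have /andP[lo hi] := xi i.
by move: (Num.floor _) lo hi => k lo hi; rewrite inordK; lia.
Qed.

Lemma measurable_BL_integrand n J (d : 'I_J -> nat)
    (pi : forall j, 'Hom('rV[R]_n, 'rV[R]_(d j))) (p : 'I_J -> R)
    (f : forall j, 'rV[R]_(d j) -> R) :
  (forall j, BL_admissible (f j)) ->
  measurable_fun setT (fun x => \prod_j f j (pi j x) `^ p j).
Proof.
move=> fadm.
apply: measurable_prod => j _.
rewrite (_ : (fun _ => _) =
    (@powR R ^~ (p j)) \o (f j \o (fun x => x *m lin1_mx (pi j)))); last first.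
  by apply/funext => x /=; rewrite mul_rV_lin1.
apply: measurableT_comp; first exact: measurable_powR.
apply: measurableT_comp; first exact: admissible_measurable (fadm j).
exact: measurable_mulmx.
Qed.

(** The discrete inequality is applied with scale [1]: points in a common unit cube
differ by at most one, so separated points have distinct integer parts. *)
Lemma BL_le n J (d : 'I_J -> nat) (pi : forall j, 'Hom('rV[R]_n, 'rV[R]_(d j)))
    (p : 'I_J -> R) (g : R) :
  (forall j, 0 <= p j <= 1) -> rank_condition (fun j => lin1_mx (pi j)) p g ->
  exists2 C : R, 0 < C & forall r : R, 1 <= r -> (BL pi p r <= (C * r `^ g)%:E)%E.
Proof.
move=> p01 Ag; have p0 j : 0 <= p j by case/andP: (p01 j).
pose phi (K : R) := ((Num.truncn (2 * (K + 1) + 1)).+1 ^ n * 1)%N.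
have [C C0 bound] := discrete_BL_of_rank_condition p01 Ag phi (ler01 : 0 <= 1 :> R).
exists (2 * C * 4 `^ g + 1); first by rewrite ltr_wpDl // !mulr_ge0 ?powR_ge0.
move=> r r1; apply: ge_ereal_sup => _ [f fadm <-]; rewrite /BL_ratio.
have /choice[N HN] : forall j, exists N : R, 0 < N /\ (\int[leb (d j)]_y (f j y)%:E = N%:E)%E.
  by move=> j; have [N N0 NE] := admissible_integral (fadm j); exists N.
have N0 j : 0 < N j by case: (HN j).
have NE j : (\int[leb (d j)]_y (f j y)%:E = (N j)%:E)%E by case: (HN j).
rewrite (BL_denominator p NE); set D := \prod_j _.
have D0 : 0 < D by apply: prodr_gt0 => j _; exact: powR_gt0.
pose h (x : 'rV[R]_n) := \prod_j f j (pi j x) `^ p j.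
have f0 j y : 0 <= f j y by case: (fadm j).
have h0 x : 0 <= h x by apply: prodr_ge0 => j _; exact: powR_ge0.
have hD x : h x <= D.
  apply: ler_prod => j _; rewrite powR_ge0 /=.
  apply: ge0_ler_powR; rewrite ?nnegrE //; first exact: ltW.
  by rewrite -lee_fin -NE; exact: admissible_le.
have mh : measurable_fun setT h by exact: measurable_BL_integrand.
pose m := (Num.truncn r).+1.
have [mr rm] : m%:R <= r + 1 /\ r <= m%:R.
  have /andP[] := @truncn_itv R r ltac:(lra); rewrite -/m => lo hi; split; last exact: ltW.
  by rewrite /m -[_.+1%:R]natr1 lerD2r.
pose X := {ffun 'I_n -> 'I_(m + m).+1}.
have /choice[x Hx] : forall v : X, exists x : 'rV[R]_n, unit_cube (grid_vector v) x /\
    (\int[leb n]_(x in unit_cube (grid_vector v)) (h x)%:E <= (2 * h x)%:E)%E.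
  move=> v; have := @exists_half_average R _ _ (leb n) (unit_cube (grid_vector v)) h D.
  case=> [||||x vx hx]; last by exists x.
  - exact: measurable_unit_cube.
  - exact: leb_unit_cube.
  - exact: measurable_funTS.
  - by move=> x _; rewrite h0 hD.
have xv v : mxfloor (x v) = grid_vector v by apply/unit_cubeP; case: (Hx v).
have sum_le : \sum_(v in [set: X]%SET) h (x v) <= C * (4 * r) `^ g * D.
  have hE v : h (x v) = \prod_j f j (x v *m lin1_mx (pi j)) `^ p j.
    by apply: eq_bigr => j _; rewrite mul_rV_lin1.
  under eq_bigr do rewrite hE.
  apply: (bound X _ x (4 * r) (fun j v => f j (x v *m lin1_mx (pi j))) N).
  - lra.
  - move=> a K K0; apply: (@card_box R X _ _ (@grid_vector n m) a); first lra.
      move=> v; rewrite inE => /andP[_ va]; rewrite -xv.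
      have -> : mxz (mxfloor (x v)) - a = (x v - a) - (x v - mxz (mxfloor (x v))).
        by rewrite opprB [RHS]addrC subrKA.
      by apply: inboxB => //; exact: inbox_floor.
    move=> w; apply/card_le1_eqP => s t; rewrite !inE => /andP[_ /eqP sw] /andP[_ /eqP tw].
    by apply: grid_vector_inj; rewrite sw.
  - move=> v _; apply: (@inbox_le _ _ (1 + m%:R)); first lra.
    rewrite -[x v](subrK (mxz (mxfloor (x v)))); apply: inboxD; first exact: inbox_floor.
    apply/inboxP => i; rewrite xv !mxE intrB ler_norml.
    have vm : ((v i : nat)%:R : R) <= (m + m)%:R by rewrite ler_nat -ltnS.
    rewrite natrD in vm; have v0 := ler0n R (v i); apply/andP; split; lra.
  - by [].
  - by move=> j; exact: ltW.
  - move=> j S' _ S'sep; rewrite -lee_fin -NE -sumEFin.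
    apply: admissible_sum_le => // s t sS tS st.
    apply/eqP/negPn/negP => nst; have /negP := S'sep _ _ sS tS nst; apply.
    by rewrite mulmxBl; exact: inbox_same_floor.
have num_le : (\int[leb n]_(x in centered_box r) (h x)%:E <=
    (2 * (C * (4 * r) `^ g * D))%:E)%E.
  pose U := \big[setU/set0]_(v <- enum X) (unit_cube (grid_vector v) : set 'rV[R]_n).
  have mU : measurable U by apply: bigsetU_measurable => v _; exact: measurable_unit_cube.
  have mhE A : measurable_fun A (fun x => (h x)%:E).
    by apply: measurable_funTS; exact/measurable_EFinP.
  apply: (@le_trans _ _ (\int[leb n]_(x in U) (h x)%:E)%E).
    apply: ge0_subset_integral => //.
    - exact: measurable_centered_box.
    - by move=> y _; rewrite lee_fin.
    move=> y yr; have [|v vy] := @grid_vector_onto n m y.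
      by apply/inboxP => i; rewrite ler_norml; have /andP[] := yr i; lra.
    rewrite /U -bigcup_seq; exists v; first by rewrite /= mem_enum.
    by apply/unit_cubeP.
  rewrite ge0_integral_bigsetU //=; first last.
  - by move=> y _; rewrite lee_fin.
  - apply: trivIset_unit_cube => v w _ _; exact: grid_vector_inj.
  - exact: enum_uniq.
  - by move=> v; exact: measurable_unit_cube.
  apply: (@le_trans _ _ (\sum_(v <- enum X) (2 * h (x v))%:E)%E).
    by apply: lee_sum => v _; case: (Hx v).
  rewrite sumEFin lee_fin -mulr_sumr ler_wpM2l //.
  apply: le_trans sum_le; rewrite big_enum /=.
  by rewrite (eq_bigl (fun v => v \in [set: X]%SET)) // => v; rewrite finset.in_setT.
have num0 : (0 <= \int[leb n]_(x in centered_box r) (h x)%:E)%E.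
  by apply: integral_ge0 => y _; rewrite lee_fin.
move: num_le num0; rewrite -/h; case: (integral _ _ _) => [I||] //=.
rewrite !lee_fin => num_le num0; rewrite inver gt_eqF // -EFinM lee_fin ler_pdivrMr //.
apply: le_trans num_le _.
rewrite powRM; try lra.
have : 0 <= r `^ g * D by rewrite mulr_ge0 ?powR_ge0 // ltW.
lra.
Qed.

End upper.

(** * Test functions for the lower bound *)

Section lower.
Context {R : realType}.

(** Cubes are counted with multiplicity, so the integral is the number of indices even
if the centres repeat; this spares any counting of distinct cubes. *)
Lemma sum_unit_cubes_admissible (Z : finType) m (c : Z -> 'rV[int]_m) (z0 : Z)
    (f := fun y : 'rV[R]_m => \sum_z (\1_(unit_cube (c z)) y : R)) :
  BL_admissible f /\ (\int[leb m]_y (f y)%:E = (#|Z|%:R)%:E)%E.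
Proof.
have fE : (fun y => (f y)%:E) = (fun y => \sum_z (\1_(unit_cube (c z)) y)%:E)%E.
  by apply/funext => y; rewrite /f sumEFin.
have f0 y : 0 <= f y by apply: sumr_ge0.
have Icube z : (\int[leb m]_y (\1_(unit_cube (c z)) y)%:E = 1%:E)%E.
  rewrite integral_indic //; last exact: measurable_unit_cube.
  by rewrite setIT; exact: leb_unit_cube.
have fint : (\int[leb m]_y (f y)%:E = (#|Z|%:R)%:E)%E.
  rewrite fE ge0_integral_sum //.
  - rewrite (eq_bigr (fun=> 1%:E)) => [|z _]; last exact: Icube.
    by rewrite sumEFin sumr_const.
  - move=> z; apply/measurable_EFinP.
    exact: measurable_indic (measurable_unit_cube _).
split=> //; split.
- apply/integrableP; split.
    apply/measurable_EFinP/measurable_sum => z.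
    exact: measurable_indic (measurable_unit_cube _).
  rewrite (eq_integral (fun y => (f y)%:E)) => [|y _]; last by rewrite /= ger0_norm.
  by rewrite fint ltry.
- exists (mxz (c z0)); apply: lt0r_neq0; rewrite /f (bigD1 z0) //=.
  apply: ltr_pwDl; last exact: sumr_ge0.
  rewrite indicE mem_set ?ltr01 //; apply/unit_cubeP/rowP => i.
  by rewrite !mxE intrKfloor.
- exact: f0.
- move=> v x y /unit_cubeP xv /unit_cubeP yv; apply: eq_bigr => z _.
  rewrite !indicE; congr (_ (nat_of_bool _)).
  by apply/idP/idP => /set_mem /unit_cubeP e; apply/mem_set/unit_cubeP;
    rewrite ?xv ?yv // -e ?xv ?yv.
Qed.

(** Factor [B *m A = P *m D] through its rank.  A point of the thickened image is within
bounded distance of [w *m D] for an integer vector [w] with about [r ^ rank]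
possible values, so its unit cube is one of boundedly many around [w *m D]. *)
Lemma thickened_image n k m (A : 'M[R]_(n, m)) (B : 'M[R]_(k, n)) :
  exists2 c : R, 0 < c & forall r, 1 <= r -> exists f : 'rV[R]_m -> R, exists N : R,
    [/\ BL_admissible f, (\int[leb m]_y (f y)%:E = N%:E)%E,
        0 < N <= c * r ^+ \rank (B *m A) &
        forall (a : 'rV[R]_k) (e : 'rV[R]_n), inbox r a -> inbox 1 e ->
          1 <= f ((a *m B + e) *m A)].
Proof.
pose E := B *m A; pose P := col_base E; pose D := row_base E.
have PD : P *m D = B *m A by exact: mulmx_base.
clearbody P D.
pose kappa := mxl1 D + mxl1 A + 2; pose q := (Num.truncn kappa).+1.
have [[cP cD] cA] := (mxl1_ge0 P, mxl1_ge0 D, mxl1_ge0 A).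
have kappa0 : 0 <= kappa by rewrite /kappa; lra.
have kq : kappa <= q%:R by have /andP[_ /ltW] := truncn_itv kappa0.
exists ((2 * mxl1 P + 3) ^+ \rank E * ((q + q).+1 ^ m)%:R); first by
  rewrite mulr_gt0 // ?ltr0n ?expn_gt0 // exprn_gt0 //; lra.
move=> r r1.
pose M := (Num.truncn (mxl1 P * r)).+1.
have Pr0 : 0 <= mxl1 P * r by rewrite mulr_ge0 //; lra.
have [Mlo Mhi] : mxl1 P * r <= M%:R /\ (M%:R : R) <= mxl1 P * r + 1.
  have /andP[lo hi] := truncn_itv Pr0; split; first exact: ltW.
  by rewrite /M -[_.+1%:R]natr1 lerD2r.
pose Z := ({ffun 'I_(\rank E) -> 'I_(M + M).+1} * {ffun 'I_m -> 'I_(q + q).+1})%type.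
pose c (z : Z) := mxfloor (mxz (grid_vector z.1) *m D : 'rV[R]_m) + grid_vector z.2.
pose f (y : 'rV[R]_m) := \sum_z (\1_(unit_cube (c z)) y : R).
have [fadm fint] := @sum_unit_cubes_admissible Z m c ([ffun=> ord0], [ffun=> ord0]).
have cardZ : #|{: Z}| = ((M + M).+1 ^ \rank E * (q + q).+1 ^ m)%N.
  by rewrite card_prod !card_ffun !card_ord.
exists f, (#|{: Z}|%:R); split=> //.
  rewrite cardZ ltr0n muln_gt0 !expn_gt0 /= natrM mulrAC ler_wpM2r //.
  rewrite natrX -exprMn; apply: lerXn2r; rewrite ?nnegrE ?ler0n //.
    by rewrite mulr_ge0 //; lra.
  rewrite -natr1 natrD; nra.
move=> a e ar e1; set y := _ *m A.
have [|w wE] := @grid_vector_onto R (\rank E) M (a *m P).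
  exact: inbox_le Mlo (inboxM _ (le_trans ler01 r1) ar).
pose y0 := mxz (mxfloor (a *m P)) *m D.
have y0y : inbox (mxl1 D + mxl1 A) (y - y0).
  have -> : y - y0 = (a *m P - mxz (mxfloor (a *m P))) *m D + e *m A.
    by rewrite /y /y0 mulmxDl mulmxBl addrAC -!mulmxA PD.
  rewrite -[mxl1 D]mulr1 -[mxl1 A]mulr1.
  by apply: inboxD; apply: inboxM => //; exact: inbox_floor.
have [|u uE] := @grid_vector_onto R m q (mxz (mxfloor y - mxfloor y0)).
  apply: inbox_le kq _.
  have -> : mxz (mxfloor y - mxfloor y0) =
      (y - y0) - (y - mxz (mxfloor y) - (y0 - mxz (mxfloor y0))) :> 'rV[R]_m.
    by apply/rowP => i; rewrite !mxE intrB; ring.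
  apply: inboxB => //; have -> : 2 = 1 + 1 :> R by lra.
  by apply: inboxB; exact: inbox_floor.
have cE : c (w, u) = mxfloor y.
  rewrite /c /= wE uE -/y0; apply/rowP => i; rewrite !mxE intrKfloor.
  by rewrite addrC subrK.
rewrite /f (bigD1 (w, u)) //= indicE mem_set; last exact/unit_cubeP.
by rewrite lerDl sumr_ge0.
Qed.

(** Integer combinations of the rows of [B] with coefficients at most a small multiple
of [r] are separated, because [B] has a right inverse; the cubes of side
[delta] at these points are disjoint, and [h >= 1] on each of them. *)
Lemma tube_volume n k (B : 'M[R]_(k, n)) : row_free B ->
  exists2 c : R, 0 < c & forall r (h : 'rV[R]_n -> R), 1 <= r ->
    measurable_fun setT h -> (forall x, 0 <= h x) ->
    (forall (a : 'rV[R]_k) (e : 'rV[R]_n), inbox r a -> inbox 1 e ->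
       1 <= h (a *m B + e)) ->
    ((c * r ^+ k)%:E <= \int[leb n]_(x in centered_box r) (h x)%:E)%E.
Proof.
move=> /row_freeP[B' BB'].
have [cB cB'] := (mxl1_ge0 B, mxl1_ge0 B').
pose delta := (4 * (mxl1 B' + 1))^-1.
pose c1 := (2 * (mxl1 B + 1))^-1.
have delta0 : 0 < delta by rewrite invr_gt0; lra.
have delta1 : delta <= 1 / 2.
  by rewrite /delta mul1r lef_pV2 ?posrE //; lra.
have deltaB : mxl1 B' * (delta + delta) <= 1 / 2.
  have : delta * (4 * (mxl1 B' + 1)) = 1 by rewrite /delta mulVf //; apply/lt0r_neq0; lra.
  nra.
have c10 : 0 < c1 by rewrite invr_gt0; lra.
have c11 : c1 <= 1 by rewrite /c1 invf_le1; lra.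
have c1B : mxl1 B * c1 <= 1 / 2 by rewrite /c1 ler_pdivrMr; lra.
exists (c1 ^+ k * delta ^+ n); first by rewrite mulr_gt0 // exprn_gt0.
move=> r h r1 mh h0 h1.
pose M := Num.truncn (c1 * r).
have [Mlo Mhi] : (M%:R : R) <= c1 * r /\ c1 * r <= M.+1%:R.
  by have /andP[lo /ltW hi] := @truncn_itv R (c1 * r) ltac:(nra).
pose T := {ffun 'I_k -> 'I_M.+1}.
pose a (t : T) : 'rV[R]_k := \row_i ((t i : nat)%:R).
have aM t : inbox M%:R (a t).
  by apply/inboxP => i; rewrite mxE ger0_norm // ler_nat -ltnS.
have aBr t : inbox (r / 2) (a t *m B).
  by apply: inbox_le (inboxM B _ (aM t)) => //; nra.
pose b (t : T) : set 'rV[R]_n :=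
  [set x | forall i, `[(a t *m B) ord0 i, (a t *m B) ord0 i + delta[%classic (x ord0 i)].
have bE t x : b t x -> inbox delta (x - a t *m B).
  move=> xt; apply/inboxP => i; rewrite !mxE; have := xt i; rewrite /= in_itv /= mxE.
  by move=> /andP[lo hi]; rewrite ger0_norm; lra.
have mb t : measurable (b t).
  apply: (@measurable_boxrV _ R _ (fun i =>
    `[(a t *m B) ord0 i, (a t *m B) ord0 i + delta[%classic)) => i.
  exact: measurable_itv.
have lebb t : leb n (b t) = (delta ^+ n)%:E.
  rewrite (lebX (A := fun i => `[(a t *m B) ord0 i, (a t *m B) ord0 i + delta[%classic)).
    rewrite (eq_bigr (fun=> delta%:E)) => [|i _].
      by rewrite prodEFin prodr_const card_ord.
    by rewrite lebesgue_measure_itv /= lte_fin ltrDl delta0 -EFinB addrC addKr.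
  by move=> i; exact: measurable_itv.
have bdisj : trivIset [set` enum T] b.
  move=> t s _ _ [x [xt xs]]; apply/ffunP => i; apply/val_inj/eqP => /=.
  have : inbox (1 / 2) (a t - a s).
    have -> : a t - a s = ((x - a s *m B) - (x - a t *m B)) *m B'.
      by rewrite opprB [X in _ = X *m _]addrC subrKA -mulmxBl -mulmxA BB' mulmx1.
    by apply: inbox_le deltaB (inboxM _ _ (inboxB (bE _ _ xs) (bE _ _ xt))); lra.
  move=> /inboxP/(_ i); rewrite !mxE ler_norml => /andP[lo hi].
  rewrite eqn_leq -ltnS -[(s i <= t i)%N]ltnS -!(ltr_nat R) -!natr1.
  by apply/andP; split; lra.
pose U := \big[setU/set0]_(t <- enum T) b t.
have mU : measurable U by exact: bigsetU_measurable.
have mhE A : measurable_fun A (fun x => (h x)%:E).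
  by apply: measurable_funTS; exact/measurable_EFinP.
apply: (@le_trans _ _ (\int[leb n]_(x in U) (h x)%:E)%E); last first.
  apply: ge0_subset_integral => //.
  - exact: measurable_centered_box.
  - by move=> y _; rewrite lee_fin.
  move=> x; rewrite /U -bigcup_seq => -[t _ /bE xt].
  have /inboxP xr : inbox r x.
    rewrite -[x](subrK (a t *m B)); apply: inbox_le (inboxD xt (aBr t)); lra.
  by move=> i; rewrite -ler_norml.
rewrite ge0_integral_bigsetU //=; last 2 first.
- exact: enum_uniq.
- by move=> y _; rewrite lee_fin.
apply: (@le_trans _ _ (\sum_(t <- enum T) (delta ^+ n)%:E)%E); last first.
  apply: lee_sum => t _; rewrite -(lebb t) -[leLHS]mul1e -integral_cst //.
  apply: ge0_le_integral => // x /bE xt; rewrite lee_fin.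
  rewrite -[x](subrK (a t *m B)) addrC; apply: h1.
    by apply: inbox_le (aM t); nra.
  by apply: inbox_le xt; lra.
rewrite big_enum /= sumEFin lee_fin sumr_const card_ffun !card_ord -mulr_natl.
rewrite mulrAC ler_wpM2r ?exprn_ge0 ?(ltW delta0) //.
rewrite -exprMn natrX; apply: lerXn2r; rewrite ?nnegrE ?ler0n //; nra.
Qed.

End lower.

(** * The lower bound and the theorem *)

Section lower_bound.
Context {R : realType}.

Lemma prodr_powR (I : finType) (a : R) (u : I -> R) : 0 < a ->
  \prod_i a `^ u i = a `^ (\sum_i u i).
Proof.
move=> a0; elim/big_rec2: _ => [|i x y _ ->]; first by rewrite powRr0.
by rewrite powRD // (gt_eqF a0) implybT.
Qed.

Lemma BL_ge n J (d : 'I_J -> nat) (pi : forall j, 'Hom('rV[R]_n, 'rV[R]_(d j)))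
    (p : 'I_J -> R) k (B : 'M[R]_(k, n)) :
  (forall j, 0 <= p j) -> row_free B ->
  exists2 c : R, 0 < c & forall r : R, 1 <= r ->
    ((c * r `^ (k%:R - \sum_j p j * (\rank (B *m lin1_mx (pi j)))%:R))%:E
       <= BL pi p r)%E.
Proof.
move=> p0 Bfree; have [c0 c00 vol] := tube_volume Bfree.
have /choice[c cP] : forall j, exists c : R, 0 < c /\ forall r, 1 <= r ->
    exists f : 'rV[R]_(d j) -> R, exists N : R,
    [/\ BL_admissible f, (\int[leb (d j)]_y (f y)%:E = N%:E)%E,
        0 < N <= c * r ^+ \rank (B *m lin1_mx (pi j)) &
        forall (a : 'rV[R]_k) (e : 'rV[R]_n), inbox r a -> inbox 1 e ->
          1 <= f ((a *m B + e) *m lin1_mx (pi j))].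
  by move=> j; have [c ? ?] := thickened_image (lin1_mx (pi j)) B; exists c.
have c_gt0 j : 0 < c j by case: (cP j).
pose C := \prod_j c j `^ p j.
have C0 : 0 < C by apply: prodr_gt0 => j _; exact: powR_gt0.
exists (c0 / C); first by rewrite divr_gt0.
move=> r r1; have r0 : 0 < r by lra.
have /fin_all_exists[f fP] : forall j, exists f : 'rV[R]_(d j) -> R, exists N : R,
    [/\ BL_admissible f, (\int[leb (d j)]_y (f y)%:E = N%:E)%E,
        0 < N <= c j * r ^+ \rank (B *m lin1_mx (pi j)) &
        forall (a : 'rV[R]_k) (e : 'rV[R]_n), inbox r a -> inbox 1 e ->
          1 <= f ((a *m B + e) *m lin1_mx (pi j))].
  by move=> j; case: (cP j) => _; exact.
have /choice[N NP] := fP.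
have fadm j : BL_admissible (f j) by case: (NP j).
have NE j : (\int[leb (d j)]_y (f j y)%:E = (N j)%:E)%E by case: (NP j).
have N0 j : 0 < N j by case: (NP j) => _ _ /andP[].
have f1 j (a : 'rV[R]_k) (e : 'rV[R]_n) : inbox r a -> inbox 1 e ->
    1 <= f j (pi j (a *m B + e)).
  by rewrite -mul_rV_lin1; case: (NP j) => _ _ _; exact.
have f0 j y : 0 <= f j y by case: (fadm j).
apply: (@le_trans _ _ (BL_ratio pi p r f)); last first.
  by apply: ereal_sup_ubound; exists f.
rewrite /BL_ratio (BL_denominator p NE); set D := \prod_j _.
have D0 : 0 < D by apply: prodr_gt0 => j _; exact: powR_gt0.
have DC : D <= C * r `^ (\sum_j p j * (\rank (B *m lin1_mx (pi j)))%:R).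
  rewrite -prodr_powR // -big_split; apply: ler_prod => j _ /=; rewrite powR_ge0 /=.
  have [_ _ /andP[_ Nle] _] := NP j.
  rewrite (mulrC (p j)) powRrM powR_mulrn ?(ltW r0) //.
  rewrite -powRM ?exprn_ge0 ?(ltW r0) ?(ltW (c_gt0 j)) //.
  apply: ge0_ler_powR; rewrite ?nnegrE ?(ltW (N0 j)) //.
  by rewrite mulr_ge0 ?exprn_ge0 ?(ltW r0) ?(ltW (c_gt0 j)).
have num : ((c0 * r ^+ k)%:E <=
    \int[leb n]_(x in centered_box r) (\prod_j f j (pi j x) `^ p j)%:E)%E.
  apply: vol => // [|x|a e ar e1].
  - exact: measurable_BL_integrand.
  - by apply: prodr_ge0 => j _; exact: powR_ge0.
  elim/big_ind: _ => [//|x y x1 y1|j _]; first exact: mulr_ege1.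
  rewrite -(powRr0 (f j (pi j (a *m B + e)))); apply: ler_powR => //; exact: f1.
rewrite inver gt_eqF //; apply: le_trans (lee_wpmul2r _ num); last first.
  by rewrite lee_fin invr_ge0 ltW.
rewrite -EFinM lee_fin powRB; last by apply/implyP => _; exact: lt0r_neq0.
rewrite powR_mulrn ?(ltW r0) // mulrACA -invfM.
rewrite ler_wpM2l ?mulr_ge0 ?exprn_ge0 ?(ltW r0) ?(ltW c00) //.
by rewrite lef_pV2 // posrE mulr_gt0 // powR_gt0.
Qed.

End lower_bound.

Section dimensions.
Context {R : realType}.

Definition rows_mx n k (s : k.-tuple 'rV[R]_n) : 'M[R]_(k, n) := \matrix_i tnth s i.

Lemma mem_span_rows n k (s : k.-tuple 'rV[R]_n) v :
  (v \in << s >>%VS) = (v <= rows_mx s)%MS.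
Proof.
have mulE (u : 'rV[R]_k) : u *m rows_mx s = \sum_i u ord0 i *: s`_i.
  by rewrite mulmx_sum_row; apply: eq_bigr => i _; rewrite rowK (tnth_nth 0).
apply/idP/submxP => [/coord_span vE|[u ->]].
  exists (\row_i coord s i v); rewrite mulE {1}vE.
  by apply: eq_bigr => i _; rewrite mxE.
rewrite mulE; apply: memv_suml => i _; apply/memvZ/memv_span/mem_nth.
by rewrite size_tuple.
Qed.

Lemma free_rows n k (s : k.-tuple 'rV[R]_n) : free s -> row_free (rows_mx s).
Proof.
move=> /freeP sfree; rewrite -kermx_eq0; apply/rowV0P => u /sub_kermxP us0.
apply/rowP => i; rewrite mxE; apply: sfree.
rewrite -[RHS]us0 mulmx_sum_row; apply: eq_bigr => j _.
by rewrite rowK (tnth_nth 0).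
Qed.

Lemma dim_span_rows n k (s : k.-tuple 'rV[R]_n) :
  \dim << s >> = \rank (rows_mx s).
Proof.
have bfree := free_rows (basis_free (vbasisP << s >>%VS)).
rewrite -(eqP bfree); apply: eqmx_rank; apply/andP; split; apply/row_subP => i.
  rewrite rowK -mem_span_rows; apply: vbasis_mem; exact: mem_tnth.
rewrite rowK -mem_span_rows (span_basis (vbasisP _)).
by apply: memv_span; exact: mem_tnth.
Qed.

Lemma dim_image_span n m k (s : k.-tuple 'rV[R]_n) (f : 'Hom('rV[R]_n, 'rV[R]_m)) :
  \dim (f @: << s >>) = \rank (rows_mx s *m lin1_mx f).
Proof.
rewrite limg_span -[map f s]/(tval [tuple of map f s]) dim_span_rows.
congr (\rank _); apply/row_matrixP => i.
by rewrite row_mul !rowK mul_rV_lin1 tnth_map.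
Qed.

Lemma BL_exponent_span n J (d : 'I_J -> nat)
    (pi : forall j, 'Hom('rV[R]_n, 'rV[R]_(d j))) (p : 'I_J -> R) k
    (s : k.-tuple 'rV[R]_n) :
  BL_exponent pi p << s >>%VS = (\rank (rows_mx s))%:R -
    \sum_j p j * (\rank (rows_mx s *m lin1_mx (pi j)))%:R.
Proof.
rewrite /BL_exponent dim_span_rows; congr (_ - _).
by apply: eq_bigr => j _; rewrite dim_image_span.
Qed.

(** The exponent depends only on the dimensions of [V] and of its images, which take
finitely many values. *)
Lemma BL_exponent_max n J (d : 'I_J -> nat)
    (pi : forall j, 'Hom('rV[R]_n, 'rV[R]_(d j))) (p : 'I_J -> R) :
  exists V0, forall V, BL_exponent pi p V <= BL_exponent pi p V0.
Proof.
pose F := ('I_n.+1 * {ffun 'I_J -> 'I_n.+1})%type.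
pose prof (V : {vspace 'rV[R]_n}) : F :=
  (inord (\dim V), [ffun j => inord (\dim (pi j @: V))]).
pose val (f : F) : R := (f.1 : nat)%:R - \sum_j p j * (f.2 j : nat)%:R.
have valE V : BL_exponent pi p V = val (prof V).
  have Vs := span_basis (vbasisP V).
  rewrite /BL_exponent /val /=; congr (_ - _).
    by rewrite inordK // ltnS -{1}Vs dim_span_rows rank_leq_col.
  apply: eq_bigr => j _; rewrite ffunE inordK // ltnS -{1}Vs dim_image_span.
  by rewrite (leq_trans (mxrankM_maxl _ _)) // rank_leq_col.
pose real f := `[< exists V, prof V = f >].
have real0 : real (prof 0%VS) by apply/asboolP; exists 0%VS.
case: (@Order.TotalTheory.arg_maxP _ _ _ (prof 0%VS) real val real0) => f.
move=> /asboolP[V0 <-] max; exists V0 => V; rewrite !valE; apply: max.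
by apply/asboolP; exists V.
Qed.

End dimensions.

Theorem theorem1 (R : realType) (n J : nat) (hn : (1 <= n)%N) (hJ : (1 <= J)%N)
    (p : 'I_J -> R) (hp : forall j, 0 <= p j <= 1)
    (d : 'I_J -> nat) (hd : forall j, (1 <= d j <= n)%N)
    (pi : forall j, 'Hom('rV[R]_n, 'rV[R]_(d j)))
    (hpi : forall j (y : 'rV[R]_(d j)), exists x, pi j x = y) :
  exists c C : R, [/\ 0 < c, 0 < C &
    forall r : R, 1 <= r ->
      (c%:E * ereal_sup [set (r `^ BL_exponent pi p V)%:E | V in setT]
         <= BL pi p r)%E /\
      (BL pi p r
         <= C%:E * ereal_sup [set (r `^ BL_exponent pi p V)%:E | V in setT])%E].
Proof.
have [V0 V0max] := BL_exponent_max pi p.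
have p0 j : 0 <= p j by case/andP: (hp j).
have rank_cond : rank_condition (fun j => lin1_mx (pi j)) p (BL_exponent pi p V0).
  move=> m W; have := V0max <<[tuple row i W | i < m]>>%VS.
  have -> : BL_exponent pi p <<[tuple row i W | i < m]>>%VS =
      (\rank W)%:R - \sum_j p j * (\rank (W *m lin1_mx (pi j)))%:R.
    rewrite BL_exponent_span; suff -> : rows_mx [tuple row i W | i < m] = W by [].
    by apply/row_matrixP => i; rewrite rowK tnth_mktuple.
  by [].
have [C C0 upper] := BL_le hp rank_cond.
have bfree := free_rows (basis_free (vbasisP V0)).
have [c c0 lower] := BL_ge pi p0 bfree.
exists c, C; split=> // r r1.
(* As [r >= 1], the supremum is attained at the subspace of largest exponent. *)
have supE : ereal_sup [set (r `^ BL_exponent pi p V)%:E | V in setT] =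
    (r `^ BL_exponent pi p V0)%:E.
  apply/eqP; rewrite eq_le; apply/andP; split.
    by apply: ge_ereal_sup => _ [V _ <-]; rewrite lee_fin ler_powR.
  by apply: ereal_sup_ubound; exists V0.
rewrite supE -!EFinM; split; last exact: upper.
have := lower r r1; congr (((_ * (r `^ _))%:E <= _)%E).
have <- : BL_exponent pi p <<vbasis V0>>%VS = BL_exponent pi p V0.
  by rewrite (span_basis (vbasisP V0)).
rewrite BL_exponent_span; congr (_%:R - _); exact/esym/eqP.
Qed.
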